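(* There is a nondeterministic polynomial parameter transformation from 3Coloring$[\mathrm{pw}]$ to Group-$S_k$ Subset Sum$[k]$.
   Context: A parameterized problem is a set $P\subseteq\Sigma^*\times\mathbb{N}$ of instances $(I,k)$. A nondeterministic polynomial parameter transformation (NPPT) from $P$ to $Q$ is an algorithm $\mathcal B$ with a polynomial $p$ such that, given $(I,k)$ and a binary string $y$ of length $p(k)$, it runs in time polynomial in $|I|+k$ and outputs an instance $(I',k')$ of $Q$ with $k'\le p(k)$; if $(I,k)\in P$ then for some $y$ the output is in $Q$; if $(I,k)\notin P$ then for every $y$ the output is not in $Q$. 3Coloring$[\mathrm{pw}]$: given an undirected graph $G$ together with a path decomposition of $G$ of width at most $\mathrm{pw}$, can $V(G)$ be colored with 3 colors so that adjacent vertices get different colors? Parameter $\mathrm{pw}$. (A path decomposition is a sequence of bags $X_1,\dots,X_r\subseteq V(G)$ such that for each vertex the indices of bags containing it form a nonempty interval, and each edge is contained in some bag; its width is $\max_i|X_i|-1$.) Group-$S_k$ Subset Sum$[k]$: given $k$, permutations $g_1,\dots,g_n$ of $[k]$ and a permutation $g$ of $[k]$, is there a subsequence $i_1<\dots<i_r$ of $[n]$ with $g_{i_1}\circ g_{i_2}\circ\dots\circ g_{i_r}=g$ (composition in $S_k$, empty product being the identity)? Parameter $k$. *)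

(* Defs.v *)
From HB Require Import structures.
From mathcomp Require Import all_boot all_order all_algebra all_fingroup.

Set Implicit Arguments.
Unset Strict Implicit.
Unset Printing Implicit Defensive.

(* Algorithms are WHILE programs over binary trees (the language of
   N. D. Jones, "Computability and Complexity", 1997): structured programs with
   finitely many variables, each of which holds a finite binary tree.

   Jones charges one unit per [cons].  Here every evaluation of a subexpression
   is charged the full size of the tree that it yields, so that sharing cannot
   be used to build large trees cheaply and the output is never larger than
   the running time plus the input.  With this measure, WHILE programs and
   multitape Turing machines simulate each other with polynomial overhead. *)

Inductive tree := Leaf | Node of tree & tree.

Fixpoint tree_size (t : tree) : nat :=
  if t is Node l r then (tree_size l + tree_size r).+1 else 1.

Inductive expr :=
  | Var of nat
  | Nil
  | Cons of expr & expr
  | Hd of expr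
  | Tl of expr.

Inductive cmd :=
  | Assign of nat & expr
  | Seq of cmd & cmd
  | If of expr & cmd & cmd
  | While of expr & cmd.

Definition store := nat -> tree.

Definition update (s : store) (x : nat) (v : tree) : store :=
  fun z => if z == x then v else s z.

Fixpoint eval (s : store) (e : expr) : tree :=
  match e with
  | Var x => s x
  | Nil => Leaf
  | Cons e1 e2 => Node (eval s e1) (eval s e2)
  | Hd e1 => if eval s e1 is Node l _ then l else Leaf
  | Tl e1 => if eval s e1 is Node _ r then r else Leaf
  end.

Fixpoint cost (s : store) (e : expr) : nat :=
  tree_size (eval s e) +
  match e with
  | Var _ | Nil => 0
  | Cons e1 e2 => cost s e1 + cost s e2
  | Hd e1 | Tl e1 => cost s e1
  end.

(* A tree counts as true in a test iff it is not [Leaf]. *)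
Definition truth (s : store) (e : expr) : bool :=
  if eval s e is Node _ _ then true else false.

(* [exec c s t s'] : started in [s], the program [c] halts in [s'] after
   time [t]. *)
Inductive exec : cmd -> store -> nat -> store -> Prop :=
  | ExecAssign x e s :
      exec (Assign x e) s (cost s e).+1 (update s x (eval s e))
  | ExecSeq c1 c2 s1 s2 s3 t1 t2 :
      exec c1 s1 t1 s2 -> exec c2 s2 t2 s3 ->
      exec (Seq c1 c2) s1 (t1 + t2).+1 s3
  | ExecIfTrue e c1 c2 s s' t :
      truth s e -> exec c1 s t s' ->
      exec (If e c1 c2) s (cost s e + t).+1 s'
  | ExecIfFalse e c1 c2 s s' t :
      ~~ truth s e -> exec c2 s t s' ->
      exec (If e c1 c2) s (cost s e + t).+1 s'
  | ExecWhileTrue e c s1 s2 s3 t1 t2 :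
      truth s1 e -> exec c s1 t1 s2 -> exec (While e c) s2 t2 s3 ->
      exec (While e c) s1 (cost s1 e + t1 + t2).+1 s3
  | ExecWhileFalse e c s :
      ~~ truth s e -> exec (While e c) s (cost s e).+1 s.

Lemma exec_det c s t1 s1 t2 s2 :
  exec c s t1 s1 -> exec c s t2 s2 -> t1 = t2 /\ s1 = s2.
Proof.
move=> H; elim: H t2 s2 => {c s t1 s1}.
- by move=> x e s t2 s2 H; inversion H.
- move=> c1 c2 s1 s2 s3 t1 t2 _ IH1 _ IH2 t s H.
  inversion H as [|? ? ? s2' ? ? ? R1 R2| | | |]; subst.
  have [-> E] := IH1 _ _ R1; rewrite -{}E in R2.
  by have [-> ->] := IH2 _ _ R2.
- move=> e c1 c2 s s' t b _ IH t2 s2 H.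
  inversion H as [| |? ? ? ? ? ? b' R|? ? ? ? ? ? b' R| |]; subst.
    by have [-> ->] := IH _ _ R.
  by rewrite b in b'.
- move=> e c1 c2 s s' t b _ IH t2 s2 H.
  inversion H as [| |? ? ? ? ? ? b' R|? ? ? ? ? ? b' R| |]; subst.
    by rewrite b' in b.
  by have [-> ->] := IH _ _ R.
- move=> e c s1 s2 s3 t1 t2 b _ IH1 _ IH2 t s H.
  inversion H as [| | | |? ? ? s2' ? ? ? b' R1 R2|? ? ? b']; subst.
    have [-> E] := IH1 _ _ R1; rewrite -{}E in R2.
    by have [-> ->] := IH2 _ _ R2.
  by rewrite b in b'.
- move=> e c s b t2 s2 H.
  inversion H as [| | | |? ? ? s2' ? ? ? b' R1 R2|? ? ? b']; subst => //.
  by rewrite b' in b.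
Qed.

Definition word := seq bool.

Definition tree_of_bool (b : bool) : tree := if b then Node Leaf Leaf else Leaf.

Definition tree_of_word (w : word) : tree :=
  foldr (fun b t => Node (tree_of_bool b) t) Leaf w.

(* Parameters are handed to and returned by programs in unary, in accordance
   with running times being measured in terms of [|I| + k]. *)
Definition tree_of_nat (k : nat) : tree := iter k (Node Leaf) Leaf.

(* Variables 0, 1, 2 initially hold the instance, the parameter and the
   nondeterministic guess; all other variables hold [Leaf]. *)
Definition init_store (I : word) (k : nat) (y : word) : store :=
  nth Leaf [:: tree_of_word I; tree_of_nat k; tree_of_word y].

(* On input [(I, k)] and [y], program [B] halts after time [t] with output
   [(I', k')], found in variables 0 and 1. *)
Definition runs (B : cmd) (I : word) (k : nat) (y : word)
    (t : nat) (I' : word) (k' : nat) : Prop :=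
  exists s : store, [/\ exec B (init_store I k y) t s,
    s 0 = tree_of_word I' & s 1 = tree_of_nat k'].

Definition param_problem := word -> nat -> Prop.

(* [{poly nat}] : polynomials with natural coefficients.  Allowing other
   coefficients gives the same notion: any polynomial is dominated by one of
   these, and superfluous guess bits can be ignored. *)
Definition is_nppt (P Q : param_problem) (B : cmd) (p : {poly nat}) : Prop :=
  [/\ exists q : {poly nat}, forall (I : word) (k : nat) (y : (p.[k]%R).-tuple bool),
        exists t I' k', [/\ runs B I k y t I' k',
          t <= q.[(size I + k)%N]%R & k' <= p.[k]%R],
      forall (I : word) (k : nat), P I k ->
        exists (y : (p.[k]%R).-tuple bool) t I' k', runs B I k y t I' k' /\ Q I' k'
    & forall (I : word) (k : nat), ~ P I k ->
        forall (y : (p.[k]%R).-tuple bool) t I' k',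
          runs B I k y t I' k' -> ~ Q I' k'].

Definition has_nppt (P Q : param_problem) : Prop :=
  exists (B : cmd) (p : {poly nat}), is_nppt P Q B p.

(* Numbers are written in unary.  All numbers that occur (the number of
   vertices, of bags or of permutations, and the values of permutations) are at
   most the size of the objects that they describe, so the encodings are
   polynomially equivalent to those with binary numerals. *)

Definition code_nat (n : nat) : word := rcons (nseq n true) false.

(* Adjacency matrix of the graph, then the bags as characteristic vectors. *)
Definition code_graph_bags (n : nat) (e : rel 'I_n) (Xs : seq {set 'I_n}) : word :=
  code_nat n ++ [seq e u v | u <- enum 'I_n, v <- enum 'I_n] ++
  code_nat (size Xs) ++ [seq v \in X | X : {set 'I_n} <- Xs, v : 'I_n <- enum 'I_n].

(* The list of values of the permutation. *)
Definition code_perm (k : nat) (h : 'S_k) : word :=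
  flatten [seq code_nat (h i) | i <- enum 'I_k].

Definition code_perms (k : nat) (gs : seq 'S_k) (g : 'S_k) : word :=
  code_nat (size gs) ++ flatten [seq code_perm h | h <- gs] ++ code_perm g.

Definition simple_graph (n : nat) (e : rel 'I_n) : Prop :=
  symmetric e /\ irreflexive e.

Definition path_decomposition (n : nat) (e : rel 'I_n) (Xs : seq {set 'I_n}) : Prop :=
  (forall v : 'I_n, exists a b : nat, a <= b < size Xs /\
     forall i : nat, i < size Xs -> (v \in nth set0 Xs i) = (a <= i <= b)) /\
  (forall u v : 'I_n, e u v -> exists2 X, X \in Xs & (u \in X) && (v \in X)).

(* The width of a sequence of empty bags is 0 here instead of -1, which makes
   no difference to being at most a given natural number. *)
Definition width (n : nat) (Xs : seq {set 'I_n}) : nat :=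
  (\max_(X <- Xs) #|X|) - 1.

Definition three_colorable (n : nat) (e : rel 'I_n) : Prop :=
  exists c : 'I_n -> 'I_3, forall u v : 'I_n, e u v -> c u != c v.

Definition three_coloring_pw : param_problem := fun I pw =>
  exists (n : nat) (e : rel 'I_n) (Xs : seq {set 'I_n}),
    [/\ I = code_graph_bags e Xs, simple_graph e, path_decomposition e Xs,
        width Xs <= pw & three_colorable e].

(* The product of permutations in MathComp applies the left factor first. *)
Definition perm_comp (k : nat) (g h : 'S_k) : 'S_k := (h * g)%g.

Lemma perm_compE k (g h : 'S_k) : perm_comp g h =1 g \o h.
Proof. by move=> x; rewrite permM. Qed.

Definition perm_comp_seq (k : nat) (gs : seq 'S_k) : 'S_k :=
  foldr (@perm_comp k) 1%g gs.

Definition group_subset_sum : param_problem := fun I k =>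
  exists (gs : seq 'S_k) (g : 'S_k),
    I = code_perms gs g /\
    exists2 hs : seq 'S_k, subseq hs gs & perm_comp_seq hs = g.

(* Main.v *)
(* Sweep along the path decomposition with S = 2 (k + 1) slots: at time t one
   bank of k + 1 slots carries the vertices of bag t, ordered by rank, and the
   other bank still carries those of bag t - 1.  The slots of the current bank
   are recolored arbitrarily, then every pair of slots is checked: equal colors
   if both carry the same vertex, different colors if they carry adjacent ones.

   In the permutation group, the component of a pair (i, j) of slots records
   both colors together with cyclic counters of all lengths up to L = 4 S.
   Recoloring slot i is an optional rotation, offered twice; the check of (i, j)
   at time t is an optional permutation that increments the counters precisely
   at the compatible pairs of colors.  Starting from color 0 everywhere, the
   counters of all pairs agree with the number r of bags iff all checks were
   selected and succeeded, because r < 2 ^ (2 S) <= lcm (1, ..., L).  The effect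
   of the product on the other starting points is out of control, so the target
   permutation is guessed, and only its entries about the run from color 0 are
   verified.

   This needs r < 3 ^ S.  Otherwise the colorings of the slots are no more
   numerous than the input bits, and the instance is solved outright by dynamic
   programming. *)

From Pilot Require Import Defs.
From mathcomp Require Import all_boot all_order all_algebra all_fingroup.
From mathcomp Require Import zify.

Set Implicit Arguments.
Unset Strict Implicit.
Unset Printing Implicit Defensive.

Import GRing.Theory.
(* Restores the constructors [Nil] and [Cons] of [expr], shadowed by seq.v. *)
Import Pilot.Defs.

(** * Polynomial-time functions on encoded data *)

(** The instances below are chosen so that the encodings of words and of numbers are convertible to
    [tree_of_word] and [tree_of_nat]. *)
Structure encType := EncType { enc_sort :> Type; enc : enc_sort -> tree }.
Arguments enc {e} x.

Canonical enc_nat := EncType tree_of_nat.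
Canonical enc_bool := EncType tree_of_bool.
Canonical enc_pair (A B : encType) :=
  EncType (fun p : A * B => Node (enc p.1) (enc p.2)).
Canonical enc_seq (A : encType) :=
  EncType (foldr (fun a : A => Node (enc a)) Leaf).

Definition sz (T : encType) (x : T) : nat := tree_size (enc x).
Arguments sz {T} x : simpl never.

Lemma tree_size_gt0 t : 0 < tree_size t.
Proof. by case: t. Qed.

Lemma sz_gt0 (T : encType) (x : T) : 0 < sz x.
Proof. exact: tree_size_gt0. Qed.

Lemma sz_nat (n : nat) : sz n = n.*2.+1.
Proof. by rewrite /sz; elim: n => //= n ->. Qed.

Lemma sz_bool (b : bool) : sz b <= 3.
Proof. by case: b. Qed.

Lemma sz_pair (A B : encType) (p : A * B) :
  sz p = (sz p.1 + sz p.2).+1.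
Proof. by []. Qed.

Lemma sz_cons (A : encType) (a : A) s : sz (a :: s) = (sz a + sz s).+1.
Proof. by []. Qed.

Lemma size_le_sz (A : encType) (s : seq A) : size s < sz s.
Proof. by elim: s => //= a s IH; rewrite sz_cons; have := sz_gt0 a; lia. Qed.

Lemma sz_nth (A : encType) (a : A) s i : i < size s -> sz (nth a s i) < sz s.
Proof.
elim: s i => //= b s IH [|i] /=; rewrite sz_cons; first by lia.
by move=> /IH; lia.
Qed.

Lemma sz_seq_le (A : encType) (s : seq A) b :
  (forall i a, i < size s -> sz (nth a s i) <= b) -> sz s <= (size s * b.+1).+1.
Proof.
elim: s => //= a s IH H; rewrite sz_cons.
have ha : sz a <= b by exact: (H 0 a).
have := IH (fun i => H i.+1); rewrite mulSn; lia.
Qed.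

Lemma sz_cat (A : encType) (s t : seq A) : sz (s ++ t) = (sz s + sz t).-1.
Proof.
elim: s => [|a s IH]; first by [].
by rewrite cat_cons !sz_cons IH; have := sz_gt0 s; lia.
Qed.

Lemma sz_rev (A : encType) (s : seq A) : sz (rev s) = sz s.
Proof.
elim: s => //= a s IH.
rewrite rev_cons -cats1 sz_cat IH !sz_cons.
by have -> : sz ([::] : seq A) = 1 by []; have := sz_gt0 s; lia.
Qed.

Lemma horner_mono (p : {poly nat}) m n : m <= n -> (p.[m]%R <= p.[n]%R)%N.
Proof.
elim/poly_ind: p m n => [|p c IH] m n mn; first by rewrite !horner0.
by rewrite !hornerMXaddC; apply: leq_add => //; apply: leq_mul => //; apply: IH.
Qed.

(** * Polynomially bounded functions *)

Definition poly_bounded (A : encType) (h : A -> nat) : Prop :=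
  exists p : {poly nat}, forall a, h a <= p.[sz a]%R.

Section PolyBounded.

Context (A : encType).
Implicit Types g h : A -> nat.

Lemma pb_leq g h : (forall a, g a <= h a) -> poly_bounded h -> poly_bounded g.
Proof. by move=> gh [p hp]; exists p => a; apply: leq_trans (gh a) (hp a). Qed.

Lemma pb_sz : poly_bounded (fun a : A => sz a).
Proof. by exists 'X%R => a; rewrite hornerX. Qed.

Lemma pb_const n : poly_bounded (fun _ : A => n).
Proof. by exists n%:P%R => a; rewrite hornerC. Qed.

Lemma pb_add g h : poly_bounded g -> poly_bounded h ->
  poly_bounded (fun a => g a + h a).
Proof.
by move=> [p gp] [q hq]; exists (p + q)%R => a; rewrite hornerD; apply: leq_add.
Qed.

Lemma pb_mul g h : poly_bounded g -> poly_bounded h ->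
  poly_bounded (fun a => g a * h a).
Proof.
by move=> [p gp] [q hq]; exists (p * q)%R => a; rewrite hornerM; apply: leq_mul.
Qed.

Lemma pb_succ g : poly_bounded g -> poly_bounded (fun a => (g a).+1).
Proof.
by move=> pg; apply: pb_leq (pb_add pg (pb_const 1)) => a; rewrite addn1.
Qed.

Lemma pb_horner (p : {poly nat}) g :
  poly_bounded g -> poly_bounded (fun a => p.[g a]%R).
Proof.
move=> [q gq]; exists (p \Po q)%R => a; rewrite horner_comp.
exact: horner_mono.
Qed.

Lemma pb_comp (B : encType) (h : B -> nat) (f : A -> B) :
  poly_bounded h -> poly_bounded (fun a => sz (f a)) ->
  poly_bounded (fun a => h (f a)).
Proof. by move=> [p hp] pf; apply: pb_leq (pb_horner p pf) => a; apply: hp. Qed.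

End PolyBounded.

Arguments pb_sz {A}.
Arguments pb_const {A} n.

Ltac pb := repeat match goal with
  | H : poly_bounded ?h |- poly_bounded ?h => exact: H
  | |- poly_bounded (fun x => addn (@?g x) (@?h x)) => apply: pb_add
  | |- poly_bounded (fun x => muln (@?g x) (@?h x)) => apply: pb_mul
  | |- poly_bounded (fun x => S (@?g x)) => apply: pb_succ
  | |- poly_bounded (fun x => horner ?p (@?g x)) => apply: pb_horner
  | |- poly_bounded sz => exact: pb_sz
  | |- poly_bounded (fun x => sz x) => exact: pb_sz
  | |- poly_bounded (fun x => ?c) => exact: pb_const
  | |- _ => assumption
  end.

(** * Timed weakest preconditions and polynomial-time computability *)

Definition wp c s (Q : nat -> store -> Prop) : Prop :=
  exists t s', exec c s t s' /\ Q t s'.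

Lemma wp_mono c s (Q Q' : nat -> store -> Prop) :
  (forall t s', Q t s' -> Q' t s') -> wp c s Q -> wp c s Q'.
Proof. by move=> QQ' [t [s' [E H]]]; exists t, s'; split=> //; apply: QQ'. Qed.

Lemma wp_assign x e s (Q : nat -> store -> Prop) :
  Q (cost s e).+1 (update s x (eval s e)) -> wp (Assign x e) s Q.
Proof. by move=> H; do 2!eexists; split; first exact: ExecAssign. Qed.

Lemma wp_seq c1 c2 s (Q : nat -> store -> Prop) :
  wp c1 s (fun t1 s1 => wp c2 s1 (fun t2 s2 => Q (t1 + t2).+1 s2)) ->
  wp (Seq c1 c2) s Q.
Proof.
move=> [t1 [s1 [E1 [t2 [s2 [E2 H]]]]]].
by exists (t1 + t2).+1, s2; split=> //; apply: ExecSeq E1 E2.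
Qed.

Lemma wp_if e c1 c2 s (Q : nat -> store -> Prop) :
  wp (if truth s e then c1 else c2) s (fun t s' => Q (cost s e + t).+1 s') ->
  wp (If e c1 c2) s Q.
Proof.
case: ifPn => b [t [s' [E H]]]; exists (cost s e + t).+1, s'; split=> //.
  exact: ExecIfTrue.
exact: ExecIfFalse.
Qed.

Lemma wp_while e c s (Q : nat -> store -> Prop) :
  (if truth s e
   then wp c s (fun t1 s1 => wp (While e c) s1
          (fun t2 s2 => Q (cost s e + t1 + t2).+1 s2))
   else Q (cost s e).+1 s) ->
  wp (While e c) s Q.
Proof.
case: ifPn => b.
  move=> [t1 [s1 [E1 [t2 [s2 [E2 H]]]]]].
  by do 2!eexists; split; last exact: H; apply: ExecWhileTrue E1 E2.
by move=> H; do 2!eexists; split; last exact: H; apply: ExecWhileFalse.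
Qed.

(** Every evaluation is charged the full size of its result, so no variable grows by more than the
    elapsed time. Outputs of polynomial-time programs are therefore polynomially large. *)
Lemma exec_size c s t s' z : exec c s t s' -> tree_size (s' z) <= tree_size (s z) + t.
Proof.
have cost_eval s0 e : tree_size (eval s0 e) <= cost s0 e.
  by case: e => [x||e1 e2|e1|e1] /=; lia.
move=> E; elim: E z => {c s t s'} //=.
- by move=> x e s z; rewrite /update; have := cost_eval s e; case: eqP => _; lia.
- by move=> c1 c2 s1 s2 s3 t1 t2 _ IH1 _ IH2 z; have := IH1 z; have := IH2 z; lia.
- by move=> e c1 c2 s s' t _ _ IH z; have := IH z; lia.
- by move=> e c1 c2 s s' t _ _ IH z; have := IH z; lia.
- by move=> e c s1 s2 s3 t1 t2 _ _ IH1 _ IH2 z; have := IH1 z; have := IH2 z; lia.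
- by move=> *; lia.
Qed.

(** Only variable 0 is constrained at the start, and variables above [N] survive. Programs thus
    compose without clearing scratch variables, and intermediate values can be parked in [N.+1],
    [N.+2] and so on. *)
Definition computes (A B : encType) (f : A -> B) (c : cmd) (N : nat)
    (tm : A -> nat) : Prop :=
  forall s a, s 0 = enc a -> wp c s (fun t s' =>
    [/\ s' 0 = enc (f a), t <= tm a & forall z, N < z -> s' z = s z]).

Definition ptime (A B : encType) (f : A -> B) : Prop :=
  exists c N tm, poly_bounded tm /\ computes f c N tm.

(** Values of different types may share an encoding. One program then serves for [cons] and pairing,
    for successor and pairing with [false], for numbers and lists of [false]. *)
Lemma ptime_recode (A B C : encType) (f : A -> B) (g : A -> C) :
  (forall a, enc (f a) = enc (g a)) -> ptime f -> ptime g.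
Proof.
move=> fg [c [N [tm [ptm H]]]]; exists c, N, tm; split=> // s a s0.
by apply: wp_mono (H s a s0) => t s' []; rewrite fg.
Qed.

Lemma ptime_ext (A B : encType) (f g : A -> B) : f =1 g -> ptime f -> ptime g.
Proof. by move=> fg; apply: ptime_recode => a; rewrite fg. Qed.

Lemma pb_sz_ptime (A B : encType) (f : A -> B) :
  ptime f -> poly_bounded (fun a => sz (f a)).
Proof.
move=> [c [N [tm [ptm H]]]]; apply: pb_leq (pb_add pb_sz ptm) => a.
have [t [s' [E [E0 tle _]]]] := H (fun=> enc a) a erefl.
have := exec_size 0 E; rewrite E0 /sz; lia.
Qed.

Lemma ptime_const (A B : encType) (b : B) : ptime (fun _ : A => b).
Proof.
(* An expression that rebuilds a fixed tree; neither its value nor its cost depends on the store. *)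
pose fix e t := if t is Node l r then Cons (e l) (e r) else Nil.
have evE s t : eval s (e t) = t by elim: t => //= l -> r ->.
exists (Assign 0 (e (enc b))), 0, (fun a => (cost (fun=> Leaf) (e (enc b))).+1).
split; first by pb.
move=> s a s0; apply: wp_assign; split=> //.
- by rewrite /update /= evE.
- rewrite ltnS.
  suff cE s1 s2 t : cost s1 (e t) = cost s2 (e t) by rewrite (cE s (fun=> Leaf)).
  by elim: t => //= l -> r ->; rewrite !evE.
- by move=> z; rewrite /update; case: z.
Qed.

Lemma ptime_expr (A B : encType) (f : A -> B) (e : expr) :
  (forall s a, s 0 = enc a -> eval s e = enc (f a)) ->
  (exists h : A -> nat, poly_bounded h /\ forall s a, s 0 = enc a -> cost s e <= h a) ->
  ptime f.
Proof.
move=> ev [h [ph ch]].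
exists (Assign 0 e), 0, (fun a => (h a).+1); split; first by pb.
move=> s a s0; apply: wp_assign; split.
- by rewrite /update /= (ev _ a).
- by rewrite ltnS ch.
- by move=> z; rewrite /update; case: z.
Qed.

Lemma ptime_comp (A B C : encType) (f : A -> B) (g : B -> C) :
  ptime f -> ptime g -> ptime (fun a => g (f a)).
Proof.
move=> pf [cg [Ng [tg [ptg Hg]]]]; have pszf := pb_sz_ptime pf.
case: pf => [cf [Nf [tf [ptf Hf]]]].
exists (Seq cf cg), (maxn Nf Ng), (fun a => (tf a + tg (f a)).+1); split.
  by pb; apply: pb_comp.
move=> s a s0; apply: wp_seq; apply: wp_mono (Hf s a s0) => t1 s1 [s10 t1le fr1].
apply: wp_mono (Hg s1 _ s10) => t2 s2 [s20 t2le fr2]; split=> //; first by lia.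
by move=> z zN; rewrite fr2 ?fr1 //; lia.
Qed.

Lemma ptime_pair (A B C : encType) (f : A -> B) (g : A -> C) :
  ptime f -> ptime g -> ptime (fun a => (f a, g a)).
Proof.
move=> pf pg; have pszf := pb_sz_ptime pf; have pszg := pb_sz_ptime pg.
case: pf pg => [cf [Nf [tf [ptf Hf]]]] [cg [Ng [tg [ptg Hg]]]].
pose N := maxn Nf Ng.
(* [N.+1] keeps the input while [f] runs, [N.+2] keeps the value of [f] while [g] runs. *)
exists (Seq (Assign N.+1 (Var 0)) (Seq cf (Seq (Assign N.+2 (Var 0))
  (Seq (Assign 0 (Var N.+1)) (Seq cg
    (Assign 0 (Cons (Var N.+2) (Var 0)))))))), N.+2,
  (fun a => tf a + tg a + 3 * (sz a + sz (f a) + sz (g a)) + 20); split.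
  by pb.
move=> s a s0; apply: wp_seq; apply: wp_assign => /=; apply: wp_seq.
set s1 := update _ _ _; have s10 : s1 0 = enc a by rewrite /s1 /update.
apply: wp_mono (Hf s1 a s10) => t2 s2 [s20 t2le fr2]; apply: wp_seq.
apply: wp_assign => /=; apply: wp_seq; apply: wp_assign => /=; apply: wp_seq.
set s3 := update _ _ _.
have s2N : s2 N.+1 = enc a by rewrite fr2 /s1 /update ?eqxx // /N; lia.
have s30 : s3 0 = enc a by rewrite /s3 /update /= ifF ?s2N //; lia.
apply: wp_mono (Hg s3 a s30) => t4 s4 [s40 t4le fr4]; apply: wp_assign => /=.
have s4N : s4 N.+2 = enc (f a).
  by rewrite fr4 /s3 /update /= ?eqxx ?s20 // /N; lia.
have -> : update s2 N.+2 (s2 0) N.+1 = enc a by rewrite /update ifF ?s2N //; lia.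
rewrite s4N s40 s20 s0; split.
- by [].
- by rewrite /sz; lia.
- move=> z zN; rewrite /update ifF; last by lia.
  rewrite fr4; last by lia.
  rewrite /s3 /update !ifF; try lia.
  by rewrite fr2 /s1 /update ?ifF //; lia.
Qed.

Lemma ptime_if (A B : encType) (b : A -> bool) (f g : A -> B) :
  ptime b -> ptime f -> ptime g -> ptime (fun a => if b a then f a else g a).
Proof.
move=> [cb [Nb [tb [ptb Hb]]]] [cf [Nf [tf [ptf Hf]]]] [cg [Ng [tg [ptg Hg]]]].
pose N := maxn Nb (maxn Nf Ng).
exists (Seq (Assign N.+1 (Var 0)) (Seq cb (Seq (Assign N.+2 (Var 0))
  (Seq (Assign 0 (Var N.+1)) (If (Var N.+2) cf cg))))), N.+2,
  (fun a => tb a + tf a + tg a + 3 * sz a + 20); split.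
  by pb.
move=> s a s0; apply: wp_seq; apply: wp_assign => /=; apply: wp_seq.
set s1 := update _ _ _; have s10 : s1 0 = enc a by rewrite /s1 /update.
apply: wp_mono (Hb s1 a s10) => t2 s2 [s20 t2le fr2]; apply: wp_seq.
apply: wp_assign => /=; apply: wp_seq; apply: wp_assign => /=.
have s2N : s2 N.+1 = enc a by rewrite fr2 /s1 /update ?eqxx // /N; lia.
set s3 := update _ 0 _; apply: wp_if.
have s30 : s3 0 = enc a by rewrite /s3 /update /= ifF ?s2N //; lia.
have s3N : s3 N.+2 = enc (b a) by rewrite /s3 /update /= eqxx s20.
rewrite /truth /= s3N s20 s0.
have fr3 z : N.+2 < z -> s3 z = s z.
  move=> zN; rewrite /s3 /update !ifF; try lia.
  by rewrite fr2 /s1 /update ?ifF //; lia.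
have -> : update s2 N.+2 (enc (b a)) N.+1 = enc a by rewrite /update ifF ?s2N //; lia.
have szb := sz_bool (b a); rewrite /sz in szb.
case: (b a) szb => /= szb.
  apply: wp_mono (Hf s3 a s30) => t4 s4 [s40 t4le fr4].
  split=> //; first by rewrite /sz; lia.
  by move=> z zN; rewrite fr4 ?fr3 //; lia.
apply: wp_mono (Hg s3 a s30) => t4 s4 [s40 t4le fr4].
split=> //; first by rewrite /sz; lia.
by move=> z zN; rewrite fr4 ?fr3 //; lia.
Qed.

Lemma ptime_id (A : encType) : ptime (fun a : A => a).
Proof.
apply: (@ptime_expr A A _ (Var 0)) => //; exists (@sz A); split=> [|s a s0].
  exact: pb_sz.
by rewrite /= s0 addn0.
Qed.

Lemma ptime_fst (A B C : encType) (f : C -> A * B) :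
  ptime f -> ptime (fun x => (f x).1).
Proof.
move=> pf; apply: (ptime_comp pf).
apply: (@ptime_expr (enc_pair A B) _ _ (Hd (Var 0))) => [s a /= ->//|].
exists (fun a => sz a + sz a); split=> [|s a /= ->]; first by pb.
by rewrite /sz /=; lia.
Qed.

Lemma ptime_snd (A B C : encType) (f : C -> A * B) :
  ptime f -> ptime (fun x => (f x).2).
Proof.
move=> pf; apply: (ptime_comp pf).
apply: (@ptime_expr (enc_pair A B) _ _ (Tl (Var 0))) => [s a /= ->//|].
exists (fun a => sz a + sz a); split=> [|s a /= ->]; first by pb.
by rewrite /sz /=; lia.
Qed.

Lemma ptime_cons (A C : encType) (f : C -> A) (g : C -> seq A) :
  ptime f -> ptime g -> ptime (fun x => f x :: g x).
Proof. by move=> pf pg; apply: ptime_recode (ptime_pair pf pg). Qed.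

Lemma ptime_behead (A C : encType) (f : C -> seq A) :
  ptime f -> ptime (fun x => behead (f x)).
Proof.
move=> pf; apply: (ptime_comp pf).
apply: (@ptime_expr (enc_seq A) _ _ (Tl (Var 0))) => [s a /= ->//|]; first by case: a.
exists (fun a => sz a + sz a); split=> [|s a /= ->]; first by pb.
by case: a => // x s'; rewrite /sz /=; lia.
Qed.

(* The hypothesis on [a0] is needed because [Hd] yields [Leaf] on [Leaf]. *)
Lemma ptime_head (A C : encType) (a0 : A) (f : C -> seq A) :
  enc a0 = Leaf -> ptime f -> ptime (fun x => head a0 (f x)).
Proof.
move=> a0L pf; apply: (ptime_comp pf).
apply: (@ptime_expr (enc_seq A) _ _ (Hd (Var 0))) => [s a /= ->//|]; first by case: a.
exists (fun a => sz a + sz a); split=> [|s a /= ->]; first by pb.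
by case: a => // x s'; rewrite /sz /=; lia.
Qed.

Lemma ptime_pos (C : encType) (f : C -> nat) :
  ptime f -> ptime (fun x => f x != 0).
Proof.
move=> pf.
apply: (ptime_comp (B := enc_nat) (C := enc_bool) (g := fun n : nat => n != 0) pf); exists
  (If (Var 0) (Assign 0 (Cons Nil Nil)) (Assign 0 Nil)), 0,
  (fun n : enc_nat => sz n + 20).
split; first by pb.
move=> s n s0; apply: wp_if; rewrite /truth /= s0.
by case: n s0 => [|n] s0; apply: wp_assign; split=> //; rewrite /sz /=; try lia;
  case.
Qed.

(** * Bounded iteration over lists *)

Section Foldl.

Context (X A E : encType).

(** [vx] holds the fixed argument, [vl] the remaining list and [va] the accumulator. With all
    accumulators bounded by [b], a round costs at most [T] plus copying, and induction on the list
    adds up the rounds. *)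
Lemma wp_foldl (f : X * (A * E) -> A) c N tm x (M T b : nat) vx vl va :
  computes f c N tm -> N < vx -> vx < vl -> vl < va ->
  (forall a e, sz a <= b -> sz e <= M -> tm (x, (a, e)) <= T) ->
  forall es s a, s vx = enc x -> s vl = enc es -> s va = enc a ->
    sz es <= M ->
    (forall i, sz (foldl (fun a e => f (x, (a, e))) a (take i es)) <= b) ->
    wp (While (Var vl) (Seq (Assign 0 (Cons (Var vx) (Cons (Var va) (Hd (Var vl)))))
         (Seq c (Seq (Assign va (Var 0)) (Assign vl (Tl (Var vl))))))) s
      (fun t s' => [/\ t <= (size es).+1 * (T + 10 * (M + b + sz x) + 100),
         s' va = enc (foldl (fun a e => f (x, (a, e))) a es) &
         forall z, N < z -> z != vl -> z != va -> s' z = s z]).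
Proof.
move=> Hc Nx xl la HT; elim=> [|e es IH] s a sx sl sa esM Hb; apply: wp_while.
  by rewrite /truth /= sl /=; split=> //; rewrite /sz /=; lia.
rewrite /truth /= sl /=; apply: wp_seq; apply: wp_assign; apply: wp_seq.
rewrite /= sx sl sa /=.
set s1 := update _ _ _; have s10 : s1 0 = enc (x, (a, e)) by [].
apply: wp_mono (Hc s1 _ s10) => t2 s2 [s20 t2le fr2]; apply: wp_seq.
apply: wp_assign => /=; apply: wp_assign => /=.
set s3 := update _ vl _.
have s3E z : N < z -> z != vl -> z != va -> s3 z = s z.
  move=> z1 z2 z3; rewrite /s3 /update !ifF; try lia.
  by rewrite fr2 /s1 /update ?ifF //; lia.
have s3x : s3 vx = enc x by rewrite s3E //; lia.
have s2l : s2 vl = Node (enc e) (enc es).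
  by rewrite fr2 /s1 /update ?ifF ?sl //; lia.
have s2l' : update s2 va (s2 0) vl = Node (enc e) (enc es).
  by rewrite /update ifF ?s2l //; lia.
have s3l : s3 vl = enc es by rewrite /s3 s2l' /update eqxx.
have s3a : s3 va = enc (f (x, (a, e))).
  by rewrite /s3 /update ifF ?eqxx ?s20 //; lia.
rewrite sz_cons in esM.
have esM' : sz es <= M by lia.
have b0 : sz a <= b by have := Hb 0.
have b1 : sz (f (x, (a, e))) <= b by have := Hb 1; rewrite /= take0.
have Hb' i : sz (foldl (fun a e => f (x, (a, e))) (f (x, (a, e))) (take i es)) <= b.
  exact: (Hb i.+1).
apply: wp_mono (IH s3 _ s3x s3l s3a esM' Hb') => t4 s4 [t4le s4a fr4].
split=> //; last by move=> z z1 z2 z3; rewrite fr4 ?s3E.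
have tle : tm (x, (a, e)) <= T by apply: HT => //; lia.
rewrite s2l' s20 /=; rewrite /sz in b0 b1 esM t4le *.
have -> : foldr (fun a0 : E => Node (enc a0)) Leaf es = enc es by [].
(* The cost of one round becomes an atom, so that peeling off one round leaves linear arithmetic. *)
set U := T + _ + 100 in t4le *.
have UE : U = T + 10 * (M + b + tree_size (enc x)) + 100 by [].
by rewrite [_.+2 * U]mulSn; move: (_ * U) t4le => U' t4le; lia.
Qed.

(* The bound on the intermediate accumulators cannot be dropped: iterating a
   polynomial-time function may lead out of polynomial time. *)
Lemma ptime_foldl (b : X -> nat) (f : X -> A -> E -> A) (l : X -> seq E) (a : X -> A) :
  poly_bounded b ->
  (forall x i, sz (foldl (f x) (a x) (take i (l x))) <= b x) ->
  ptime (fun z : X * (A * E) => f z.1 z.2.1 z.2.2) -> ptime l -> ptime a ->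
  ptime (fun x => foldl (f x) (a x) (l x)).
Proof.
move=> pb Hb pf pl pa.
have pszl := pb_sz_ptime pl; have psza := pb_sz_ptime pa.
case: pf pl pa => [cf [Nf [tf [[pf tfp] Hf]]]] [cl [Nl [tl [ptl Hl]]]]
  [ca [Na [ta [pta Ha]]]].
pose N := maxn Nf (maxn Nl Na).
pose loop := While (Var N.+2)
  (Seq (Assign 0 (Cons (Var N.+1) (Cons (Var N.+3) (Hd (Var N.+2)))))
    (Seq cf (Seq (Assign N.+3 (Var 0)) (Assign N.+2 (Tl (Var N.+2)))))).
(* A bound on the time of one application of [f], taken at the largest size of [(x, (a, e))] that
   can occur. *)
pose T x := (pf.[(sz x + (b x + sz (l x)).+1).+1])%R.
exists (Seq (Assign N.+1 (Var 0)) (Seq cl (Seq (Assign N.+2 (Var 0))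
  (Seq (Assign 0 (Var N.+1)) (Seq ca (Seq (Assign N.+3 (Var 0))
    (Seq loop (Assign 0 (Var N.+3))))))))), N.+3,
  (fun x => tl x + ta x + sz (l x) * (T x + 10 * (sz (l x) + b x + sz x) + 100)
     + 10 * (sz x + b x + sz (l x) + sz (a x)) + 100).
split; first by rewrite /T; pb.
move=> s x s0; apply: wp_seq; apply: wp_assign => /=; apply: wp_seq.
set s1 := update _ _ _; have s10 : s1 0 = enc x by rewrite /s1 /update.
apply: wp_mono (Hl s1 x s10) => t2 s2 [s20 t2le fr2]; apply: wp_seq.
apply: wp_assign => /=; apply: wp_seq; apply: wp_assign => /=; apply: wp_seq.
have s2N : s2 N.+1 = enc x by rewrite fr2 /s1 /update ?eqxx // /N; lia.
have -> : update s2 N.+2 (s2 0) N.+1 = enc x by rewrite /update ifF ?s2N //; lia.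
set s3 := update _ 0 _; have s30 : s3 0 = enc x by [].
have fr3 z : N.+2 < z -> s3 z = s z.
  move=> zN; rewrite /s3 /update !ifF; try lia.
  by rewrite fr2 /s1 /update ?ifF //; lia.
have s3x : s3 N.+1 = enc x by rewrite /s3 /update ifF; rewrite ?ifF ?s2N //; lia.
have s3l : s3 N.+2 = enc (l x) by rewrite /s3 /update eqxx s20.
apply: wp_mono (Ha s3 x s30) => t4 s4 [s40 t4le fr4]; apply: wp_seq.
apply: wp_assign => /=; apply: wp_seq.
set s5 := update s4 _ _.
have s5x : s5 N.+1 = enc x by rewrite /s5 /update ifF ?fr4 //; lia.
have s5l : s5 N.+2 = enc (l x) by rewrite /s5 /update ifF ?fr4 //; lia.
have s5a : s5 N.+3 = enc (a x) by rewrite /s5 /update eqxx s40.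
have HT a' e : sz a' <= b x -> sz e <= sz (l x) -> tf (x, (a', e)) <= T x.
  move=> ha he; apply: leq_trans (tfp _) _; apply: horner_mono.
  by rewrite !sz_pair /=; lia.
have Nf1 : Nf < N.+1 by rewrite /N; lia.
have := wp_foldl Hf Nf1 (ltnSn _) (ltnSn _) HT s5x s5l s5a (leqnn _) (Hb x).
apply: wp_mono => t6 s6 [t6le s6a' fr6]; apply: wp_assign => /=.
have {s6a'} s6a : s6 N.+3 = enc (foldl (f x) (a x) (l x)) by [].
split.
- by rewrite /update /= s6a.
- have lsz := size_le_sz (l x).
  have b1 := Hb x (size (l x)); rewrite take_size in b1.
  set U := T x + _ + 100 in t6le *.
  have lU : (size (l x)).+1 * U <= sz (l x) * U by rewrite leq_mul2r lsz orbT.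
  move: (_ * U) (_ * U) t6le lU => U1 U2 t6le lU.
  by rewrite s0 s20 s40 s6a; rewrite /sz in b1 *; lia.
- move=> z zN; rewrite /update ifF; last by lia.
  rewrite fr6; try lia.
  rewrite /s5 /update ifF; last by lia.
  by rewrite fr4 ?fr3 //; lia.
Qed.

End Foldl.

(** * Boolean, arithmetic and list operations *)

Lemma ptime_negb (X : encType) (b : X -> bool) :
  ptime b -> ptime (fun x => ~~ b x).
Proof. by move=> pb; apply: (ptime_if pb (ptime_const _ false) (ptime_const _ true)). Qed.

Lemma ptime_andb (X : encType) (b c : X -> bool) :
  ptime b -> ptime c -> ptime (fun x => b x && c x).
Proof. by move=> pb pc; apply: (ptime_if pb pc (ptime_const _ false)). Qed.

Lemma ptime_orb (X : encType) (b c : X -> bool) :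
  ptime b -> ptime c -> ptime (fun x => b x || c x).
Proof. by move=> pb pc; apply: (ptime_if pb (ptime_const _ true) pc). Qed.

Lemma ptime_implb (X : encType) (b c : X -> bool) :
  ptime b -> ptime c -> ptime (fun x => b x ==> c x).
Proof. by move=> pb pc; apply: (ptime_if pb pc (ptime_const _ true)). Qed.

Lemma ptime_eqb (X : encType) (b c : X -> bool) :
  ptime b -> ptime c -> ptime (fun x => b x == c x).
Proof.
move=> pb pc; apply: ptime_ext (ptime_if pb pc (ptime_negb pc)) => x.
by case: (b x) (c x) => -[].
Qed.

Lemma ptime_all (X E : encType) (P : X -> E -> bool) (l : X -> seq E) :
  ptime (fun z : X * E => P z.1 z.2) -> ptime l -> ptime (fun x => all (P x) (l x)).
Proof.
move=> pP pl; pose f x b e := b && P x e.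
apply: (@ptime_ext _ _ (fun x => foldl (f x) true (l x))).
  by move=> x; elim/last_ind: (l x) => // s e IH; rewrite foldl_rcons all_rcons IH andbC.
apply: (@ptime_foldl _ _ _ (fun=> 3)) => //; last exact: ptime_const.
- by pb.
- by move=> x i; apply: sz_bool.
apply: ptime_andb; first exact: ptime_fst (ptime_snd (ptime_id _)).
exact: ptime_comp (ptime_pair (ptime_fst (ptime_id _))
  (ptime_snd (ptime_snd (ptime_id _)))) pP.
Qed.

Lemma ptime_has (X E : encType) (P : X -> E -> bool) (l : X -> seq E) :
  ptime (fun z : X * E => P z.1 z.2) -> ptime l -> ptime (fun x => has (P x) (l x)).
Proof.
move=> pP pl; apply: (@ptime_ext _ _ (fun x => ~~ all (fun e => ~~ P x e) (l x))).
  by move=> x; rewrite -has_predC; apply: eq_has => e /=; rewrite negbK.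
by apply: ptime_negb; apply: ptime_all pl; apply: ptime_negb.
Qed.

Lemma ptime_succ (X : encType) (n : X -> nat) :
  ptime n -> ptime (fun x => (n x).+1).
Proof.
by move=> pn; apply: ptime_recode (ptime_pair (ptime_const _ false) pn).
Qed.

(** Unary numbers are lists of [false], so the predecessor is [behead] and bounded iteration is a
    fold over a list. *)
Lemma enc_nseq k : enc (nseq k false) = enc k.
Proof. by elim: k => //= k ->. Qed.

Lemma ptime_nseq (X : encType) (n : X -> nat) :
  ptime n -> ptime (fun x => nseq (n x) false).
Proof. by apply: ptime_recode => x; rewrite enc_nseq. Qed.

Lemma ptime_pred (X : encType) (n : X -> nat) :
  ptime n -> ptime (fun x => (n x).-1).
Proof.
move=> pn; apply: ptime_recode (ptime_behead (ptime_nseq pn)) => x.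
by rewrite -enc_nseq; case: (n x).
Qed.

Lemma ptime_size (X E : encType) (s : X -> seq E) :
  ptime s -> ptime (fun x => size (s x)).
Proof.
move=> ps; apply: (@ptime_ext _ _ (fun x => foldl (fun k (_ : E) => k.+1) 0 (s x))).
  by move=> x; elim/last_ind: (s x) => // t e IH; rewrite foldl_rcons size_rcons IH.
apply: (@ptime_foldl _ _ _ (fun x => 2 * sz (s x))) => //; last exact: ptime_const.
- by have bs := pb_sz_ptime ps; pb.
- move=> x i; have -> t : foldl (fun k (_ : E) => k.+1) 0 t = size t.
    by elim/last_ind: t => // t e IH; rewrite foldl_rcons size_rcons IH.
  rewrite sz_nat size_take_min; have := size_le_sz (s x); lia.
- cbv beta; exact: ptime_succ (ptime_fst (ptime_snd (ptime_id _))).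
Qed.

Lemma foldl_nseq (A E : Type) (f : A -> A) k (e : E) a :
  foldl (fun a _ => f a) a (nseq k e) = iter k f a.
Proof. by elim: k a => //= k IH a; rewrite IH -iterSr. Qed.

Lemma take_nseq (E : Type) i k (e : E) : take i (nseq k e) = nseq (minn i k) e.
Proof. by elim: i k => [|i IH] [|k] //=; rewrite IH minnSS. Qed.

Lemma ptime_iter (X A : encType) (b : X -> nat) (f : X -> A -> A)
  (n : X -> nat) (a : X -> A) :
  poly_bounded b -> (forall x i, i <= n x -> sz (iter i (f x) (a x)) <= b x) ->
  ptime (fun z : X * A => f z.1 z.2) -> ptime n -> ptime a ->
  ptime (fun x => iter (n x) (f x) (a x)).
Proof.
move=> pbb Hb pf pn pa.
apply: (@ptime_ext _ _
  (fun x => foldl (fun a (_ : bool) => f x a) (a x) (nseq (n x) false))).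
  by move=> x; rewrite foldl_nseq.
apply: (@ptime_foldl _ _ _ b) => //; last exact: ptime_nseq.
  by move=> x i; rewrite take_nseq foldl_nseq Hb // geq_minr.
exact: ptime_comp (ptime_pair (ptime_fst (ptime_id _))
  (ptime_fst (ptime_snd (ptime_id _)))) pf.
Qed.

Lemma ptime_addn (X : encType) (m n : X -> nat) :
  ptime m -> ptime n -> ptime (fun x => m x + n x).
Proof.
move=> pm pn; apply: (@ptime_ext _ _ (fun x => iter (n x) succn (m x))).
  by move=> x; rewrite iter_succn.
have := pb_sz_ptime pm; have := pb_sz_ptime pn => bn bm.
apply: (@ptime_iter _ _ (fun x => sz (m x) + sz (n x))) => //; first by pb.
  by move=> x i; rewrite iter_succn !sz_nat; lia.
by cbv beta; apply: ptime_succ (ptime_snd (ptime_id _)).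
Qed.

Lemma ptime_subn (X : encType) (m n : X -> nat) :
  ptime m -> ptime n -> ptime (fun x => m x - n x).
Proof.
move=> pm pn; apply: (@ptime_ext _ _ (fun x => iter (n x) predn (m x))).
  by move=> x; rewrite iter_predn.
have := pb_sz_ptime pm => bm; apply: (@ptime_iter _ _ (fun x => sz (m x))) => //.
  by move=> x i; rewrite iter_predn !sz_nat; lia.
by cbv beta; apply: ptime_pred (ptime_snd (ptime_id _)).
Qed.

Lemma ptime_muln (X : encType) (m n : X -> nat) :
  ptime m -> ptime n -> ptime (fun x => m x * n x).
Proof.
move=> pm pn; apply: (@ptime_ext _ _ (fun x => iter (n x) (addn (m x)) 0)).
  by move=> x; rewrite iter_addn_0.
have := pb_sz_ptime pm; have := pb_sz_ptime pn => bn bm.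
apply: (@ptime_iter _ _ (fun x => sz (m x) * sz (n x))) => //; last exact: ptime_const.
- by pb.
- move=> x i i_n; rewrite iter_addn_0 !sz_nat.
  have : m x * i <= m x * n x by rewrite leq_mul2l i_n orbT.
  rewrite -!muln2; nia.
- cbv beta; apply: ptime_addn (ptime_snd (ptime_id _)).
  by apply: ptime_comp (ptime_fst (ptime_id _)) pm.
Qed.

Lemma ptime_leq (X : encType) (m n : X -> nat) :
  ptime m -> ptime n -> ptime (fun x => m x <= n x).
Proof.
move=> pm pn; apply: ptime_ext (ptime_negb (ptime_pos (ptime_subn pm pn))) => x.
by rewrite negbK.
Qed.

Lemma ptime_eqn (X : encType) (m n : X -> nat) :
  ptime m -> ptime n -> ptime (fun x => m x == n x).
Proof.
move=> pm pn; apply: ptime_ext (ptime_andb (ptime_leq pm pn) (ptime_leq pn pm)) => x.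
by rewrite eqn_leq.
Qed.

Lemma foldl_cons (T : Type) (s t : seq T) : foldl (fun u e => e :: u) t s = catrev s t.
Proof. by elim: s t => //= e s IH t; rewrite IH. Qed.

Lemma sz_take (E : encType) (s : seq E) i : sz (take i s) <= sz s.
Proof.
elim: s i => [|e s IH] [|i] //=; rewrite ?sz_cons.
by have := IH i; lia.
Qed.

Lemma ptime_catrev (X E : encType) (s t : X -> seq E) :
  ptime s -> ptime t -> ptime (fun x => catrev (s x) (t x)).
Proof.
move=> ps pt; apply: (@ptime_ext _ _ (fun x => foldl (fun u e => e :: u) (t x) (s x))).
  by move=> x; rewrite foldl_cons.
have := pb_sz_ptime ps; have := pb_sz_ptime pt => bt bs.
apply: (@ptime_foldl _ _ _ (fun x => sz (s x) + sz (t x))) => //; first by pb.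
  move=> x i; rewrite foldl_cons catrevE sz_cat sz_rev.
  by have := sz_take (s x) i; lia.
by cbv beta; apply: ptime_cons (ptime_snd (ptime_snd (ptime_id _)))
  (ptime_fst (ptime_snd (ptime_id _))).
Qed.

Lemma ptime_rev (X E : encType) (s : X -> seq E) :
  ptime s -> ptime (fun x => rev (s x)).
Proof. by move=> ps; apply: ptime_catrev ps (ptime_const _ [::]). Qed.

Lemma ptime_cat (X E : encType) (s t : X -> seq E) :
  ptime s -> ptime t -> ptime (fun x => s x ++ t x).
Proof.
move=> ps pt; apply: ptime_ext (ptime_catrev (ptime_rev ps) pt) => x.
by rewrite catrevE revK.
Qed.

(** A left fold that conses builds its result backwards; the same detour through [rev] serves for
    [map] and [flatten]. *)
Lemma ptime_filter (X E : encType) (s : X -> seq E) (P : X -> E -> bool) :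
  ptime (fun z : X * E => P z.1 z.2) -> ptime s -> ptime (fun x => filter (P x) (s x)).
Proof.
move=> pP ps; pose f x u e := if P x e then e :: u else u.
have fE x u : foldl (f x) [::] u = rev (filter (P x) u).
  elim/last_ind: u => // u e IH; rewrite foldl_rcons filter_rcons IH /f.
  by case: ifP => // _; rewrite rev_rcons.
have := pb_sz_ptime ps => bs.
apply: ptime_ext (ptime_rev _) => [x|]; first by rewrite -[RHS]revK -fE.
apply: (@ptime_foldl _ _ _ (fun x => sz (s x))) => //; last exact: ptime_const.
  move=> x i; rewrite fE sz_rev; apply: leq_trans (sz_take _ i).
  elim: (take i _) => //= e u IH; case: ifP => _; rewrite !sz_cons; lia.
apply: ptime_if; last exact: ptime_fst (ptime_snd (ptime_id _)).
  exact: ptime_comp (ptime_pair (ptime_fst (ptime_id _))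
    (ptime_snd (ptime_snd (ptime_id _)))) pP.
by cbv beta; apply: ptime_cons (ptime_snd (ptime_snd (ptime_id _)))
  (ptime_fst (ptime_snd (ptime_id _))).
Qed.

Lemma ptime_count (X E : encType) (s : X -> seq E) (P : X -> E -> bool) :
  ptime (fun z : X * E => P z.1 z.2) -> ptime s -> ptime (fun x => count (P x) (s x)).
Proof.
move=> pP ps; apply: ptime_ext (ptime_size (ptime_filter pP ps)) => x.
exact: size_filter.
Qed.

Lemma ptime_find (X E : encType) (s : X -> seq E) (P : X -> E -> bool) :
  ptime (fun z : X * E => P z.1 z.2) -> ptime s -> ptime (fun x => find (P x) (s x)).
Proof.
move=> pP ps.
(* The flag records the first hit and freezes the index. *)
pose f x (u : bool * nat) e := if u.1 || P x e then (true, u.2) else (false, u.2.+1).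
have fE x u : foldl (f x) (false, 0) u = (has (P x) u, find (P x) u).
  elim/last_ind: u => // u e IH; rewrite foldl_rcons IH has_rcons -cats1 find_cat /f /=.
  case hP: (has _ u) => /=; first by rewrite orbT.
  by rewrite (hasNfind (negbT hP)) orbF; case: (P x e); rewrite ?addn0 ?addn1.
have := pb_sz_ptime ps => bs.
apply: (@ptime_ext _ _ (fun x => (foldl (f x) (false, 0) (s x)).2)) => [x|].
  by rewrite fE.
apply: ptime_snd.
apply: (@ptime_foldl _ _ _ (fun x => 2 * sz (s x) + 4)) => //; last exact: ptime_const.
- by pb.
- move=> x i; rewrite fE sz_pair sz_nat /=; have := sz_bool (has (P x) (take i (s x))).
  have := find_size (P x) (take i (s x)); have := size_le_sz (s x).
  by rewrite size_take_min; lia.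
have p1 : ptime (fun z : X * (bool * nat * E) => z.2.1.2).
  exact: ptime_snd (ptime_fst (ptime_snd (ptime_id _))).
apply: ptime_if.
- apply: ptime_orb; first exact: ptime_fst (ptime_fst (ptime_snd (ptime_id _))).
  exact: ptime_comp (ptime_pair (ptime_fst (ptime_id _))
    (ptime_snd (ptime_snd (ptime_id _)))) pP.
- exact: ptime_pair (ptime_const _ true) p1.
- exact: ptime_pair (ptime_const _ false) (ptime_succ p1).
Qed.

Lemma ptime_drop (X E : encType) (s : X -> seq E) (n : X -> nat) :
  ptime n -> ptime s -> ptime (fun x => drop (n x) (s x)).
Proof.
move=> pn ps; apply: (@ptime_ext _ _ (fun x => iter (n x) behead (s x))).
  move=> x; elim: (n x) (s x) => [|k IH] u; first by rewrite drop0.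
  by rewrite iterSr IH; case: u.
have := pb_sz_ptime ps => bs; apply: (@ptime_iter _ _ (fun x => sz (s x))) => //.
  move=> x i _; elim: i => //= i IH; apply: leq_trans IH.
  by case: (iter i _ _) => // e u; rewrite sz_cons /=; lia.
by cbv beta; apply: ptime_behead (ptime_snd (ptime_id _)).
Qed.

Lemma ptime_nth (X E : encType) (s : X -> seq E) (e0 : E) (n : X -> nat) :
  enc e0 = Leaf -> ptime s -> ptime n -> ptime (fun x => nth e0 (s x) (n x)).
Proof.
move=> e0L ps pn; apply: ptime_ext (ptime_head e0L (ptime_drop pn ps)) => x.
by rewrite -nth0 nth_drop addn0.
Qed.

Lemma ptime_map (X E F : encType) (s : X -> seq E) (f : X -> E -> F) :
  ptime (fun z : X * E => f z.1 z.2) -> ptime s -> ptime (fun x => map (f x) (s x)).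
Proof.
move=> pf ps; pose g x u e := f x e :: u.
have gE x u : foldl (g x) [::] u = rev (map (f x) u).
  by elim/last_ind: u => // u e IH; rewrite foldl_rcons map_rcons IH /g rev_rcons.
have [p fp] := pb_sz_ptime pf; have := pb_sz_ptime ps => bs.
apply: ptime_ext (ptime_rev _) => [x|]; first by rewrite -[RHS]revK -gE.
(* Each image has size at most [p] at a bound for the size of [(x, e)], and there are fewer than
   [sz (s x)] images. *)
apply: (@ptime_foldl _ _ _ (fun x =>
  (sz (s x) * (p.[(sz x + sz (s x)).+1]%R).+1).+1)) => //; last exact: ptime_const.
- by pb.
- move=> x i; rewrite gE sz_rev.
  apply: leq_trans (sz_seq_le (b := p.[(sz x + sz (s x)).+1]%R) _) _.
  + move=> j e; rewrite size_map => j_lt; move: (sz_take (s x) i) j_lt.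
    case: (take i (s x)) => // a u szu j_lt.
    rewrite (nth_map a) //; apply: leq_trans (fp (x, _)) _.
    by apply: horner_mono; rewrite sz_pair /=; have := sz_nth a j_lt; lia.
  + rewrite ltnS; apply: leq_mul => //; rewrite size_map size_take_min.
    by have := size_le_sz (s x); lia.
apply: ptime_cons (ptime_fst (ptime_snd (ptime_id _))).
exact: ptime_comp (ptime_pair (ptime_fst (ptime_id _))
  (ptime_snd (ptime_snd (ptime_id _)))) pf.
Qed.

Lemma ptime_flatten (X E : encType) (s : X -> seq (seq E)) :
  ptime s -> ptime (fun x => flatten (s x)).
Proof.
move=> ps; pose f u v : seq E := catrev v u.
have fE u : foldl f [::] u = rev (flatten u).
  elim/last_ind: u => // u v IH; rewrite foldl_rcons IH /f catrevE.
  by rewrite -cats1 flatten_cat rev_cat /= cats0.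
have := pb_sz_ptime ps => bs.
apply: ptime_ext (ptime_rev _) => [x|]; first by rewrite -[RHS]revK -fE.
apply: (@ptime_foldl _ _ _ (fun x => sz (s x))) => //; last exact: ptime_const.
  have szf (v : seq (seq E)) : sz (flatten v) <= sz v.
    by elim: v => //= u v IH; rewrite sz_cat sz_cons; lia.
  by move=> x i; rewrite fE sz_rev; apply: leq_trans (szf _) (sz_take _ i).
exact: ptime_catrev (ptime_snd (ptime_snd (ptime_id _)))
  (ptime_fst (ptime_snd (ptime_id _))).
Qed.

Lemma ptime_iota (X : encType) (n : X -> nat) :
  ptime n -> ptime (fun x => iota 0 (n x)).
Proof.
move=> pn; pose f (u : seq nat) := size u :: u.
have fE k : iter k f [::] = rev (iota 0 k).
  elim: k => // k IH; rewrite iterS IH /f size_rev size_iota.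
  by rewrite -[in RHS]addn1 (iotaD 0 k 1) rev_cat.
have bn := pb_sz_ptime pn.
apply: (@ptime_ext _ _ (fun x => rev (iter (n x) f [::]))) => [x|].
  by rewrite fE revK.
apply: ptime_rev; apply: (@ptime_iter _ _ (fun x => (sz (n x) * (sz (n x)).+1).+1)).
- by pb.
- move=> x i i_n; rewrite fE sz_rev.
  apply: leq_trans (sz_seq_le (b := sz (n x)) _) _.
    move=> j e; rewrite size_iota => j_i; rewrite nth_iota // !sz_nat; lia.
  by rewrite ltnS size_iota leq_mul // sz_nat; lia.
- apply: ptime_cons (ptime_snd (ptime_id _)).
  by apply: ptime_size (ptime_snd (ptime_id _)).
- exact: pn.
- exact: ptime_const.
Qed.

Lemma ptime_rcons (X E : encType) (s : X -> seq E) (e : X -> E) :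
  ptime s -> ptime e -> ptime (fun x => rcons (s x) (e x)).
Proof.
move=> ps pe.
apply: ptime_ext (ptime_cat ps (ptime_cons pe (ptime_const _ [::]))) => x.
by rewrite cats1.
Qed.

(* Hook for functions that become available after [pt]. *)
Ltac pt_user := fail.

(** Syntax-directed: the closure lemma of the outermost operation is applied, and the body of a list
    operation becomes a function of the pair of parameter and element. *)
Ltac pt := repeat (cbv beta; match goal with
  | |- ptime (fun x => x) => exact: ptime_id
  | H : ptime ?f |- ptime ?f => exact: H
  | H : ptime ?f |- ptime (fun x => ?f (@?g x)) => apply: (ptime_comp (f := g) _ H)
  | |- ptime (@fst _ _) => exact: ptime_fst (ptime_id _)
  | |- ptime (@snd _ _) => exact: ptime_snd (ptime_id _)
  | |- ptime (fun x => fst (@?f x)) => apply: ptime_fst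
  | |- ptime (fun x => snd (@?f x)) => apply: ptime_snd
  | |- ptime (fun x => pair (@?f x) (@?g x)) => apply: ptime_pair
  | |- ptime (fun x => negb (@?f x)) => apply: ptime_negb
  | |- ptime (fun x => andb (@?f x) (@?g x)) => apply: ptime_andb
  | |- ptime (fun x => orb (@?f x) (@?g x)) => apply: ptime_orb
  | |- ptime (fun x => implb (@?f x) (@?g x)) => apply: ptime_implb
  | |- ptime (fun x => if _ then _ else _) => apply: ptime_if
  | |- ptime (fun x => @eq_op _ (@?f x) (@?g x)) =>
      first [apply: ptime_eqn | apply: ptime_eqb]
  | |- ptime (fun x => leq (@?f x) (@?g x)) => apply: ptime_leq
  | |- ptime (fun x => addn (@?f x) (@?g x)) => apply: ptime_addn
  | |- ptime (fun x => subn (@?f x) (@?g x)) => apply: ptime_subn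
  | |- ptime (fun x => muln (@?f x) (@?g x)) => apply: ptime_muln
  | |- ptime (fun x => predn (@?f x)) => apply: ptime_pred
  | |- ptime (fun x => cons (@?f x) (@?g x)) => apply: ptime_cons
  | |- ptime (fun x => cat (@?f x) (@?g x)) => apply: ptime_cat
  | |- ptime (fun x => rcons (@?f x) (@?g x)) => apply: ptime_rcons
  | |- ptime (fun x => rev (@?f x)) => apply: ptime_rev
  | |- ptime (fun x => flatten (@?f x)) => apply: ptime_flatten
  | |- ptime (fun x => size (@?f x)) => apply: ptime_size
  | |- ptime (fun x => iota 0 (@?f x)) => apply: ptime_iota
  | |- ptime (fun x => nseq (@?f x) false) => apply: ptime_nseq
  | |- ptime (fun x => drop (@?f x) (@?g x)) => apply: ptime_drop
  | |- ptime (fun x => nth _ (@?f x) (@?g x)) => apply: ptime_nth => //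
  | |- ptime (fun x => @all _ (@?P x) (@?l x)) => apply: (@ptime_all _ _ P l)
  | |- ptime (fun x => @has _ (@?P x) (@?l x)) => apply: (@ptime_has _ _ P l)
  | |- ptime (fun x => @filter _ (@?P x) (@?l x)) =>
      apply: (@ptime_filter _ _ l P)
  | |- ptime (fun x => @count _ (@?P x) (@?l x)) => apply: (@ptime_count _ _ l P)
  | |- ptime (fun x => @find _ (@?P x) (@?l x)) => apply: (@ptime_find _ _ l P)
  | |- ptime (fun x => @map _ _ (@?f x) (@?l x)) => apply: (@ptime_map _ _ _ l f)
  | |- ptime _ => pt_user
  | |- ptime (fun x => ?c) => exact: ptime_const
  | |- ptime (fun x => S (@?f x)) => apply: ptime_succ
  end).

(** For positive [d] the quotient counts the positive multiples of [d] up to [m]; since it is at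
    most [m], candidates below [m] suffice. *)
Lemma divn_count m d :
  m %/ d = if d == 0 then 0 else count (fun q => q.+1 * d <= m) (iota 0 m).
Proof.
case: eqP => [->|/eqP]; rewrite ?divn0 // -lt0n => d0.
rewrite (eq_count (a2 := fun q => q < m %/ d)); last by move=> q; rewrite leq_divRL.
by rewrite -size_filter (@filter_iota_ltn 0) ?size_iota ?leq_div.
Qed.

Lemma ptime_divn (X : encType) (m d : X -> nat) :
  ptime m -> ptime d -> ptime (fun x => m x %/ d x).
Proof.
move=> pm pd; apply: (@ptime_ext _ _ (fun x => if d x == 0 then 0 else
  count (fun q => q.+1 * d x <= m x) (iota 0 (m x)))).
  by move=> x; rewrite -divn_count.
by pt.
Qed.

Lemma ptime_modn (X : encType) (m d : X -> nat) :
  ptime m -> ptime d -> ptime (fun x => m x %% d x).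
Proof.
move=> pm pd; apply: (@ptime_ext _ _ (fun x => m x - m x %/ d x * d x)).
  by move=> x; rewrite {1}(divn_eq (m x) (d x)) addKn.
by have := ptime_divn pm pd => h; pt.
Qed.

(** * The reduction *)

Section Input.

Variable I : word.

(** The position of the first [false] inverts the prefix code [code_nat]. All readers are total;
    their values are meaningful on words that pass [valid]. *)
Definition nvert : nat := find negb I.

Definition edge (u v : nat) : bool := nth false I (nvert.+1 + u * nvert + v).

Definition bags_pos : nat := nvert.+1 + nvert * nvert.

Definition nbags : nat := find negb (drop bags_pos I).

Definition in_bag (t v : nat) : bool :=
  nth false I (bags_pos + nbags.+1 + t * nvert + v).

(** The size equation forbids missing and trailing bits, so that a valid word can be rebuilt from
    the fields read off it. *)
Definition valid (k : nat) : bool :=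
  [&& size I == bags_pos + nbags.+1 + nbags * nvert,
      all (fun u => ~~ edge u u) (iota 0 nvert),
      all (fun u => all (fun v => edge u v ==> edge v u) (iota 0 nvert)) (iota 0 nvert),
      all (fun v => has (fun a => has (fun b => (a <= b) && all (fun i =>
        in_bag i v == ((a <= i) && (i <= b))) (iota 0 nbags)) (iota 0 nbags))
        (iota 0 nbags)) (iota 0 nvert),
      all (fun u => all (fun v => edge u v ==>
        has (fun t => in_bag t u && in_bag t v) (iota 0 nbags)) (iota 0 nvert))
        (iota 0 nvert)
    & all (fun t => count (in_bag t) (iota 0 nvert) <= k.+1) (iota 0 nbags)].

(* Slot [i] is the slot of rank [i %% k.+1] in bank [i %/ k.+1]; the bank [t %% 2]
   is the current one.  At time 0 both banks carry bag 0, since [0.-1 = 0]. *)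
Definition slot_bag (k t i : nat) : nat := if i %/ k.+1 == t %% 2 then t else t.-1.

Definition has_rank (t i v : nat) : bool :=
  in_bag t v && (count (in_bag t) (iota 0 v) == i).

Definition holds (k t i v : nat) : bool := has_rank (slot_bag k t i) (i %% k.+1) v.

(** At time 0 this holds in both banks, so the all-zero coloring at the start imposes no
    constraint. *)
Definition recolored (k t i : nat) : bool := slot_bag k t i == t.

Definition compatible (k t i j a b : nat) : bool :=
  all (fun u => all (fun v => holds k t i u && holds k t j v ==>
    ((u == v) ==> (a == b)) && (edge u v ==> (a != b))) (iota 0 nvert))
    (iota 0 nvert).

End Input.

(** * Slots and dynamic programming over their colorings *)

Definition nslots (k : nat) : nat := 2 * k.+1.

(* A number stands for the coloring of the slots given by its ternary digits. *)
Definition digit (i x : nat) : nat := iter i (fun y => y %/ 3) x %% 3.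

Definition stepb (I : word) (k t x x' : nat) : bool :=
  all (fun i => recolored k t i || (digit i x' == digit i x)) (iota 0 (nslots k)) &&
  all (fun i => all (fun j => compatible I k t i j (digit i x') (digit j x'))
    (iota 0 (nslots k))) (iota 0 (nslots k)).

(** Searching below [size I] keeps the table polynomial; in the case in which the result is used,
    this range contains all codes below [3 ^ nslots k]. *)
Definition reachable (I : word) (k : nat) : seq nat :=
  foldl (fun acc t => filter (fun x' => has (fun x => stepb I k t x x') acc)
    (iota 0 (size I))) [:: 0] (iota 0 (nbags I)).

(** * The permutations and the output *)

Definition ncycles (k : nat) : nat := 4 * nslots k.

Definition degree (k : nat) : nat :=
  nslots k * nslots k * 3 * 3 * ncycles k * ncycles k.

(* [i], [j] are slots, [a], [b] their colors, and [c] is a position on the cycle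
   [0, ..., m]; the positions [c > m] are never moved. *)
Definition point (k i j a b m c : nat) : nat :=
  ((((i * nslots k + j) * 3 + a) * 3 + b) * ncycles k + m) * ncycles k + c.

Definition pt_c (k x : nat) : nat := x %% ncycles k.
Definition pt_m (k x : nat) : nat := x %/ ncycles k %% ncycles k.
Definition pt_b (k x : nat) : nat := x %/ ncycles k %/ ncycles k %% 3.
Definition pt_a (k x : nat) : nat := x %/ ncycles k %/ ncycles k %/ 3 %% 3.
Definition pt_j (k x : nat) : nat :=
  x %/ ncycles k %/ ncycles k %/ 3 %/ 3 %% nslots k.
Definition pt_i (k x : nat) : nat :=
  x %/ ncycles k %/ ncycles k %/ 3 %/ 3 %/ nslots k.

Definition turn (b : bool) (a : nat) : nat := if b then a.+1 %% 3 else a.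

(* [(t, (i, j))] is the check of the slots [i] and [j] at time [t] if
   [j < nslots k], and the rotation of slot [i] otherwise. *)
Definition op : Type := nat * (nat * nat).

(** A failed check fixes the point. Rotating a slot that is not recolored is the identity, and at a
    pair (i, i) a rotation turns both color coordinates together. *)
Definition op_fun (I : word) (k : nat) (o : op) (x : nat) : nat :=
  if o.2.2 < nslots k then
    if [&& pt_i k x == o.2.1, pt_j k x == o.2.2,
        compatible I k o.1 o.2.1 o.2.2 (pt_a k x) (pt_b k x) & pt_c k x <= pt_m k x]
    then point k (pt_i k x) (pt_j k x) (pt_a k x) (pt_b k x) (pt_m k x)
           ((pt_c k x).+1 %% (pt_m k x).+1)
    else x
  else point k (pt_i k x) (pt_j k x)
         (turn (recolored k o.1 o.2.1 && (pt_i k x == o.2.1)) (pt_a k x))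
         (turn (recolored k o.1 o.2.1 && (pt_j k x == o.2.1)) (pt_b k x))
         (pt_m k x) (pt_c k x).

Definition checks (k t : nat) : seq op :=
  flatten [seq [seq (t, (i, j)) | j <- iota 0 (nslots k)] | i <- iota 0 (nslots k)].

Definition turns (k t : nat) : seq op :=
  flatten [seq [:: (t, (i, nslots k)); (t, (i, nslots k))] | i <- iota 0 (nslots k)].

(* Products are composed from right to left, so the operations are listed in
   reverse chronological order. *)
Definition ops (k r : nat) : seq op :=
  flatten [seq checks k t ++ turns k t | t <- rev (iota 0 r)].

(** Each entry is [code_nat (f x)], spelled through [nseq _ false], the form that [ptime_nseq]
    handles. *)
Definition code_table (n : nat) (f : nat -> nat) : word :=
  flatten [seq rcons (map (fun=> true) (nseq (f x) false)) false | x <- iota 0 n].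

(* The guess is read as a permutation matrix.  Should it not be one, then
   [guessed] is no permutation and the output encodes no instance at all. *)
Definition guessed (k : nat) (y : word) (x : nat) : nat :=
  find (fun z => nth false y (x * degree k + z)) (iota 0 (degree k)).

Definition counters_ok (I : word) (k : nat) (y : word) : bool :=
  all (fun i => all (fun j => all (fun m =>
    pt_c k (guessed k y (point k i j 0 0 m 0)) == nbags I %% m.+1)
    (iota 0 (ncycles k))) (iota 0 (nslots k))) (iota 0 (nslots k)).

Definition subset_sum_code (I : word) (k : nat) (y : word) : word :=
  rcons (map (fun=> true) (nseq (size (ops k (nbags I))) false)) false ++
  flatten [seq code_table (degree k) (op_fun I k o) | o <- ops k (nbags I)] ++
  code_table (degree k) (guessed k y).

(** [[:: false]] encodes the empty list of permutations of the empty set, with the identity as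
    target; the empty word encodes nothing. *)
Definition yes_instance : word * nat := ([:: false], 0).
Definition no_instance : word * nat := ([::], 0).

(** The iterated quotient is positive iff [3 ^ nslots k <= size I]; dividing repeatedly avoids
    writing this power in unary. *)
Definition reduction (z : word * (nat * word)) : word * nat :=
  let I := z.1 in let k := z.2.1 in let y := z.2.2 in
  if ~~ valid I k then no_instance
  else if 0 < iter (nslots k) (fun x => x %/ 3) (size I) then
    if has (fun=> true) (reachable I k) then yes_instance else no_instance
  else if counters_ok I k y then (subset_sum_code I k y, degree k)
  else no_instance.

(** * Polynomial running time of the reduction *)

Ltac pt_user ::= match goal with
  | |- ptime (fun x => divn (@?f x) (@?g x)) => apply: ptime_divn
  | |- ptime (fun x => modn (@?f x) (@?g x)) => apply: ptime_modn
  end.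

Lemma sz_iter_div3 i n : sz (iter i (fun y => y %/ 3) n) <= sz n.
Proof. by elim: i => //= i IH; apply: leq_trans IH; rewrite !sz_nat; lia. Qed.

Lemma ptime_iter_div3 (X : encType) (i n : X -> nat) :
  ptime i -> ptime n -> ptime (fun z => iter (i z) (fun y => y %/ 3) (n z)).
Proof.
move=> pi pn; apply: (@ptime_iter _ _ (fun z => sz (n z)) (fun=> divn^~ 3)) => //.
- exact: pb_sz_ptime.
- by move=> x k _; apply: sz_iter_div3.
by pt.
Qed.

Ltac pt_user ::= match goal with
  | |- ptime (fun x => divn (@?f x) (@?g x)) => apply: ptime_divn
  | |- ptime (fun x => modn (@?f x) (@?g x)) => apply: ptime_modn
  | |- ptime (fun x => iter (@?i x) (fun y => divn y 3) (@?g x)) =>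
      apply: ptime_iter_div3
  end.

Lemma ptime_reachable : ptime (fun z : word * nat => reachable z.1 z.2).
Proof.
(* Every accumulator is [[:: 0]], of size 3, or a sublist of [iota 0 (size I)]. *)
apply: (@ptime_foldl _ _ _ (fun z => sz (iota 0 (size z.1)) + 2)).
- have bi : poly_bounded (fun z : word * nat => sz (iota 0 (size z.1))).
    by apply: pb_sz_ptime; pt.
  by pb.
- move=> [I k] i; case: (take i _) / lastP => [|l t].
    exact: (leq_add (sz_gt0 (iota 0 (size I))) (leqnn 2)).
  rewrite foldl_rcons; set P := (fun x' => _).
  apply: leq_trans (_ : sz (iota 0 (size I)) <= _); last by rewrite /= leq_addr.
  by elim: (iota 0 _) => //= e s IH; case: ifP => _; rewrite !sz_cons; lia.
- rewrite /stepb /compatible /holds /has_rank /recolored /slot_bag /digit.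
  by rewrite /in_bag /nbags /bags_pos /edge /nvert /nslots; pt.
- by rewrite /nbags /bags_pos /nvert; pt.
- exact: ptime_const.
Qed.

Lemma ptime_valid : ptime (fun z : word * nat => valid z.1 z.2).
Proof.
by rewrite /valid /in_bag /nbags /bags_pos /edge /nvert; pt.
Qed.

Lemma ptime_counters_ok :
  ptime (fun z : word * (nat * word) => counters_ok z.1 z.2.1 z.2.2).
Proof.
rewrite /counters_ok /pt_c /guessed /point /degree /ncycles.
by rewrite /nbags /bags_pos /nvert /nslots; pt.
Qed.

Lemma ptime_subset_sum_code :
  ptime (fun z : word * (nat * word) => subset_sum_code z.1 z.2.1 z.2.2).
Proof.
rewrite /subset_sum_code /code_table /guessed /ops /checks /turns /op_fun /turn.
rewrite /pt_i /pt_j /pt_a /pt_b /pt_m /pt_c /point /degree /ncycles.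
rewrite /compatible /holds /has_rank /recolored /slot_bag.
by rewrite /in_bag /nbags /bags_pos /edge /nvert /nslots; pt.
Qed.

Lemma ptime_reduction : ptime reduction.
Proof.
rewrite /reduction.
have pv := ptime_valid; have pc := ptime_counters_ok; have ps := ptime_subset_sum_code.
apply: ptime_if.
  by apply: ptime_negb; apply: (ptime_comp (f := fun z => (z.1, z.2.1)) _ pv); pt.
apply: ptime_const.
apply: ptime_if; first by rewrite /nslots; pt.
  apply: ptime_if; try exact: ptime_const.
  apply: (@ptime_has _ _ (fun _ _ => true)); first exact: ptime_const.
  by apply: (ptime_comp (f := fun z => (z.1, z.2.1)) _ ptime_reachable); pt.
apply: ptime_if; last exact: ptime_const.
  exact: pc.
by apply: ptime_pair; first exact: ps; rewrite /degree /ncycles /nslots; pt.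
Qed.

(** * Counters, prefix codes and runs *)

(* The recurrence 1 / ((m+1) C(n+1, m+1)) = 1 / (m C(n, m)) - 1 / (m C(n+1, m))
   of the Leibniz harmonic triangle, cleared of denominators. *)
Lemma mul_bin_dvdn D N : (forall q, 0 < q <= N -> q %| D) ->
  forall m n, 0 < m <= n -> n <= N -> m * 'C(n, m) %| D.
Proof.
move=> HD; elim=> // m IH n; case: (posnP m) => [-> | m0] /andP[_ mn] nN.
  by rewrite mul1n bin1 HD // nN andbT.
case: n mn nN => // n; rewrite ltnS => mn nN.
have /dvdnP[g1 D1] : m * 'C(n, m) %| D by apply: IH; rewrite ?m0 // ltnW.
have /dvdnP[g2 D2] : m * 'C(n.+1, m) %| D by apply: IH; rewrite ?m0 //= ltnW.
(* As the recurrence predicts, the new cofactor is the difference of the cofactors of m C(n, m) and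
   m C(n+1, m). *)
apply/dvdnP; exists (g1 - g2); apply/eqP; rewrite -(eqn_pmul2l m0); apply/eqP.
have Q1 := mul_bin_diag n.+1 m; have Q2 := mul_bin_left n.+1 m.
have -> : m * ((g1 - g2) * (m.+1 * 'C(n.+1, m.+1))) =
    (g1 * (m * (m.+1 * 'C(n.+1, m.+1)))) - (g2 * (m * (m.+1 * 'C(n.+1, m.+1)))).
  by rewrite mulnCA mulnBl.
rewrite -{1}Q1 Q2 (mulnCA m) (mulnCA g1) -D1 (mulnCA m) (mulnCA g2) -D2 -mulnBl.
by congr (_ * _); lia.
Qed.

(** By Pascal's rule and symmetry, C(2n+2, n+1) is a sum of two binomials that are each at least
    C(2n, n). *)
Lemma leq_exp2_bin n : 2 ^ n <= 'C(n.*2, n).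
Proof.
elim: n => // n IH; rewrite doubleS binS expnS mul2n -addnn leq_add //.
  by rewrite binS; apply: leq_trans IH _; rewrite leq_addl.
rewrite -bin_sub; last by lia.
by rewrite (_ : _ - n = n.+1); [rewrite binS (leq_trans IH) // leq_addl | lia].
Qed.

(** The difference is divisible by every number from 1 to 2n, hence by n C(2n, n), which is at least
    2^n for positive n and thus exceeds the difference. *)
Lemma eq_of_mods n x y : x < 2 ^ n -> y < 2 ^ n ->
  (forall m, m < n.*2 -> x = y %[mod m.+1]) -> x = y.
Proof.
wlog xy : x y / x <= y => [wl|] xn yn H.
  by case: (leqP x y) => [/wl|/ltnW/wl h]; [exact | apply/esym/h => // m /H].
case: (posnP n) => [n0|n0].
  by move: xn yn; rewrite n0; case: x y {xy H} => [|x] [|y].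
have HD q : 0 < q <= n.*2 -> q %| y - x.
  by case: q => // q q_n; rewrite -eqn_mod_dvd //; apply/eqP/esym/H.
have /(mul_bin_dvdn HD) /(_ _)/dvdn_leq h : 0 < n <= n.*2 by rewrite n0 -addnn leq_addl.
case: (posnP (y - x)) => [|d0]; first by lia.
have := h d0 (leqnn _); have := leq_exp2_bin n => h1 h2.
have : 'C(n.*2, n) <= n * 'C(n.*2, n) by rewrite leq_pmull.
by lia.
Qed.

(** * Prefix codes *)

Lemma code_nat_inj m n (s t : word) :
  code_nat m ++ s = code_nat n ++ t -> m = n /\ s = t.
Proof.
by rewrite /code_nat; elim: m n => [|m IH] [|n] //= [] // /IH[-> ->].
Qed.

Lemma code_nats_inj (l l' : seq nat) (s t : word) : size l = size l' ->
  flatten (map code_nat l) ++ s = flatten (map code_nat l') ++ t ->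
  l = l' /\ s = t.
Proof.
elim: l l' => [|a l IH] [|b l'] //= [sz]; rewrite -!catA.
by move=> /code_nat_inj[-> /(IH _ sz)[-> ->]].
Qed.

Lemma find_code_nat n (s : word) : find negb (code_nat n ++ s) = n.
Proof. by elim: n => //= n ->. Qed.

(** * Runs of the slots *)

Section Run.

Variables (I : word) (k : nat).

(** The propositional form of [stepb] for colorings given as functions, whose values matter at slots
    only. *)
Definition step (t : nat) (s s' : nat -> nat) : Prop :=
  [/\ forall i, i < nslots k -> s' i < 3,
      forall i, i < nslots k -> recolored k t i || (s' i == s i)
    & forall i j, i < nslots k -> j < nslots k -> compatible I k t i j (s' i) (s' j)].

Fixpoint run (r : nat) (s : nat -> nat) : Prop :=
  if r is r'.+1 then exists2 s0, run r' s0 & step r' s0 s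
  else forall i, i < nslots k -> s i = 0.

Lemma digitP n (s : nat -> nat) : (forall i, i < n -> s i < 3) ->
  exists2 x, x < 3 ^ n & forall i, i < n -> digit i x = s i.
Proof.
elim: n s => [|n IH] s H; first by exists 0.
have [x xn xE] := IH (fun i => s i.+1) (fun i => H i.+1).
have s0 := H 0 isT; exists (x * 3 + s 0); first by rewrite expnS; lia.
case=> [|i] i_n; first by rewrite /digit /= modnMDl modn_small.
by rewrite /digit iterSr divnMDl // divn_small // addn0; apply: xE.
Qed.

Lemma digit_lt3 i x : digit i x < 3.
Proof. exact: ltn_pmod. Qed.

Lemma digit0 i : digit i 0 = 0.
Proof. by rewrite /digit (_ : iter _ _ _ = 0) //; elim: i => //= i ->. Qed.

Lemma stepbP t x x' :
  reflect (step t (digit^~ x) (digit^~ x')) (stepb I k t x x').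
Proof.
apply: (iffP andP) => [[/allP h1 /allP h2]|[h1 h2 h3]]; split=> //.
- by move=> i ik; apply: digit_lt3.
- by move=> i ik; apply: h1; rewrite mem_iota.
- move=> i j ik jk; have /h2/allP : i \in iota 0 (nslots k) by rewrite mem_iota.
  by apply; rewrite mem_iota.
- by apply/allP => i; rewrite mem_iota => /h2.
- apply/allP => i; rewrite mem_iota => /andP[_ ik]; apply/allP => j.
  by rewrite mem_iota => /andP[_ jk]; apply: h3.
Qed.

(** The codes in the table represent runs by construction. Conversely, the hypothesis puts the code
    of each coloring on a run among the candidates. *)
Lemma reachableP : 3 ^ nslots k <= size I ->
  reflect (exists s, run (nbags I) s) (has (fun=> true) (reachable I k)).
Proof.
move=> szI; pose dp r := foldl (fun acc t => filter (fun x' =>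
  has (fun x => stepb I k t x x') acc) (iota 0 (size I))) [:: 0] (iota 0 r).
have dpS r : dp r.+1 = filter (fun x' =>
    has (fun x => stepb I k r x x') (dp r)) (iota 0 (size I)).
  by rewrite /dp -[in LHS]addn1 iotaD foldl_cat.
have sound r x : x \in dp r -> run r (digit^~ x).
  elim: r x => [|r IH] x; first by rewrite inE => /eqP -> i _; apply: digit0.
  rewrite dpS mem_filter => /andP[/hasP[x0 /IH h /stepbP h'] _].
  by exists (digit^~ x0).
have complete r s : run r s ->
    exists2 x, x \in dp r & forall i, i < nslots k -> digit i x = s i.
  elim: r s => [|r IH] s /=.
    by move=> h; exists 0; rewrite ?inE // => i ik; rewrite digit0 h.
  move=> [s0 /IH[x0 x0r x0E] [h1 h2 h3]]; have [x xk xE] := digitP h1.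
  exists x => //; rewrite dpS mem_filter mem_iota add0n (leq_trans xk) // !andbT.
  apply/hasP; exists x0 => //; apply/stepbP; split=> [i _|i ik|i j ik jk].
  - exact: digit_lt3.
  - by rewrite xE // x0E // h2.
  - by rewrite !xE // h3.
apply: (iffP hasP) => [[x /sound h _]|[s /complete[x h _]]]; last by exists x.
by exists (digit^~ x).
Qed.

End Run.

Lemma iter_div3_gt0 n x : (0 < iter n (fun y => y %/ 3) x) = (3 ^ n <= x).
Proof.
have -> : iter n (fun y => y %/ 3) x = x %/ 3 ^ n.
  by elim: n => [|n IH]; rewrite ?divn1 //= IH -divnMA expnSr.
by rewrite divn_gt0 // expn_gt0.
Qed.

Arguments code_table n f : simpl never.
Arguments degree k : simpl never.
Arguments nslots k : simpl never.
Arguments ncycles k : simpl never.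
Arguments point k i j a b m c : simpl never.

(** * Selected products and runs *)

Section Group.

Variables (I : word) (k : nat).

Local Notation S := (nslots k).
Local Notation L := (ncycles k).
Local Notation K := (degree k).

Lemma nslots_gt0 : 0 < S. Proof. by rewrite /nslots mulnS. Qed.

Lemma ncycles_gt0 : 0 < L. Proof. by rewrite /ncycles muln_gt0 nslots_gt0. Qed.

(** * Mixed-radix coordinates of points *)

Section Point.

Variables i j a b m c : nat.
Hypotheses (jS : j < S) (a3 : a < 3) (b3 : b < 3) (mL : m < L) (cL : c < L).

Lemma point_lt : i < S -> point k i j a b m c < K.
Proof.
have mixed n d p q : p < n -> q < d -> p * d + q < n * d.
  by move=> pn qd; apply: leq_trans (leq_mul pn (leqnn d)); rewrite mulSn addnC ltn_add2r.
by move=> iS; rewrite /point /degree; do 5!(apply: (mixed); last by []).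
Qed.

Lemma pt_c_point : pt_c k (point k i j a b m c) = c.
Proof. by rewrite /pt_c modnMDl modn_small. Qed.

Let divL : point k i j a b m c %/ L = (((i * S + j) * 3 + a) * 3 + b) * L + m.
Proof. by rewrite divnMDl ?ncycles_gt0 // divn_small // addn0. Qed.

Let divLL : point k i j a b m c %/ L %/ L = ((i * S + j) * 3 + a) * 3 + b.
Proof. by rewrite divL divnMDl ?ncycles_gt0 // divn_small // addn0. Qed.

Lemma pt_m_point : pt_m k (point k i j a b m c) = m.
Proof. by rewrite /pt_m divL modnMDl modn_small. Qed.

Lemma pt_b_point : pt_b k (point k i j a b m c) = b.
Proof. by rewrite /pt_b divLL modnMDl modn_small. Qed.

Lemma pt_a_point : pt_a k (point k i j a b m c) = a.
Proof.
by rewrite /pt_a divLL divnMDl // divn_small // addn0 modnMDl modn_small.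
Qed.

Let div33 : point k i j a b m c %/ L %/ L %/ 3 %/ 3 = i * S + j.
Proof.
by rewrite divLL divnMDl // (divn_small b3) addn0 divnMDl // (divn_small a3) addn0.
Qed.

Lemma pt_j_point : pt_j k (point k i j a b m c) = j.
Proof. by rewrite /pt_j div33 modnMDl modn_small. Qed.

Lemma pt_i_point : pt_i k (point k i j a b m c) = i.
Proof. by rewrite /pt_i div33 divnMDl ?nslots_gt0 // divn_small // addn0. Qed.

End Point.

Lemma point_digits x :
  point k (pt_i k x) (pt_j k x) (pt_a k x) (pt_b k x) (pt_m k x) (pt_c k x) = x.
Proof. by rewrite /point /pt_i /pt_j /pt_a /pt_b /pt_m /pt_c -!divn_eq. Qed.

Lemma pt_c_lt x : pt_c k x < L. Proof. exact: ltn_pmod ncycles_gt0. Qed.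
Lemma pt_m_lt x : pt_m k x < L. Proof. exact: ltn_pmod ncycles_gt0. Qed.
Lemma pt_b_lt x : pt_b k x < 3. Proof. exact: ltn_pmod. Qed.
Lemma pt_a_lt x : pt_a k x < 3. Proof. exact: ltn_pmod. Qed.
Lemma pt_j_lt x : pt_j k x < S. Proof. exact: ltn_pmod nslots_gt0. Qed.
Lemma pt_i_lt x : x < K -> pt_i k x < S.
Proof.
by rewrite /degree => xK; rewrite /pt_i !ltn_divLR ?ncycles_gt0 ?nslots_gt0 //.
Qed.

Lemma turn_lt q a : a < 3 -> turn q a < 3.
Proof. by rewrite /turn; case: q => // _; apply: ltn_pmod. Qed.

Lemma turn_inj q a b : a < 3 -> b < 3 -> turn q a = turn q b -> a = b.
Proof. by case: q => //; case: a b => [|[|[|a]]] [|[|[|b]]]. Qed.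

(** * Operations as permutations *)

Definition new_c (o : op) (x : nat) : nat :=
  if [&& o.2.2 < S, pt_i k x == o.2.1, pt_j k x == o.2.2,
      compatible I k o.1 o.2.1 o.2.2 (pt_a k x) (pt_b k x) & pt_c k x <= pt_m k x]
  then (pt_c k x).+1 %% (pt_m k x).+1 else pt_c k x.

Definition turned (o : op) (i : nat) : bool :=
  [&& S <= o.2.2, recolored k o.1 o.2.1 & i == o.2.1].

(** Puts both kinds of operations into one coordinatewise formula: a check turns no color, and a
    rotation moves no counter. *)
Lemma op_funE o x : op_fun I k o x =
  point k (pt_i k x) (pt_j k x) (turn (turned o (pt_i k x)) (pt_a k x))
    (turn (turned o (pt_j k x)) (pt_b k x)) (pt_m k x) (new_c o x).
Proof.
rewrite /op_fun /new_c /turned (leqNgt S); case: ifP => //= _.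
by case: ifP => //; rewrite point_digits.
Qed.

Lemma new_c_lt o x : new_c o x < L.
Proof.
rewrite /new_c; case: ifP => _; last exact: pt_c_lt.
by apply: leq_trans (pt_m_lt x); apply: ltn_pmod.
Qed.

Lemma op_fun_lt o x : x < K -> op_fun I k o x < K.
Proof.
move=> xK; rewrite op_funE; apply: point_lt; rewrite ?turn_lt ?pt_a_lt ?pt_b_lt //.
- exact: pt_j_lt.
- exact: pt_m_lt.
- exact: new_c_lt.
- exact: pt_i_lt.
Qed.

(** The coordinates are recovered in turn: slots and cycle length are unchanged, and the colors turn
    by an amount that depends on the slots only. With these known, the counter is either fixed or
    rotated on [0, m] and fixed above, which is injective. *)
Lemma op_fun_inj o x y : op_fun I k o x = op_fun I k o y -> x = y.
Proof.
rewrite !op_funE => E.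
have D z : [/\ pt_j k z < S, turn (turned o (pt_i k z)) (pt_a k z) < 3,
    turn (turned o (pt_j k z)) (pt_b k z) < 3, pt_m k z < L & new_c o z < L].
  by rewrite pt_j_lt pt_m_lt new_c_lt !turn_lt ?pt_a_lt ?pt_b_lt.
have [x1 x2 x3 x4 x5] := D x; have [y1 y2 y3 y4 y5] := D y.
have Ei := congr1 (pt_i k) E; rewrite !pt_i_point // in Ei.
have Ej := congr1 (pt_j k) E; rewrite !pt_j_point // in Ej.
have Ea := congr1 (pt_a k) E; rewrite !pt_a_point // Ei in Ea.
have Eb := congr1 (pt_b k) E; rewrite !pt_b_point // Ej in Eb.
have Em := congr1 (pt_m k) E; rewrite !pt_m_point // in Em.
have Ec := congr1 (pt_c k) E; rewrite !pt_c_point // in Ec.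
have {}Ea := turn_inj (pt_a_lt x) (pt_a_lt y) Ea.
have {}Eb := turn_inj (pt_b_lt x) (pt_b_lt y) Eb.
suff Ec' : pt_c k x = pt_c k y.
  by rewrite -(point_digits x) Ei Ej Ea Eb Em Ec' point_digits.
move: Ec; rewrite /new_c Ei Ej Ea Eb Em.
case: (o.2.2 < S) => //; case: (_ == _) => //; case: (_ == _) => //.
case: compatible => //=; set m := pt_m k y; set c := pt_c k x; set d := pt_c k y.
have small e : e <= m -> e.+1 %% m.+1 = if e == m then 0 else e.+1.
  by rewrite leq_eqVlt; case: eqP => [-> _|_ /= em]; rewrite ?modnn // modn_small.
by case: leqP => cm; case: leqP => dm; rewrite ?small //; do 2?case: eqP; lia.
Qed.

Definition op_ord (o : op) (x : 'I_K) : 'I_K := Ordinal (op_fun_lt o (ltn_ord x)).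

Lemma op_ord_inj o : injective (op_ord o).
Proof. by move=> x y /(congr1 val) /= /op_fun_inj /val_inj. Qed.

Definition op_perm (o : op) : 'S_K := perm (@op_ord_inj o).

Lemma op_permE o x : op_perm o x = op_fun I k o x :> nat.
Proof. by rewrite permE. Qed.

Lemma perm_comp_seq_ops os x :
  perm_comp_seq (map op_perm os) x = foldr (op_fun I k) x os :> nat.
Proof.
elim: os x => [|o os IH] x /=; first by rewrite perm1.
by rewrite perm_compE /= op_permE IH.
Qed.

(* The colors of the slots and the unreduced values of the counters. *)
Definition state : Type := (nat -> nat) * (nat -> nat -> nat).

Definition state0 : state := (fun=> 0, fun _ _ => 0).

Definition op_sem (o : op) (st : state) : state :=
  (fun i => turn (turned o i) (st.1 i),
   fun i j => st.2 i j + [&& o.2.2 < S, i == o.2.1, j == o.2.2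
      & compatible I k o.1 o.2.1 o.2.2 (st.1 i) (st.1 j)]).

Lemma op_sem_lt3 os i : (foldr op_sem state0 os).1 i < 3.
Proof. by elim: os => //= o os IH; apply: turn_lt. Qed.

(** Each component carries the colors of its own two slots, which is all that an operation consults
    there. So all components started from color 0 follow one common state, and a cycle of length
    [m.+1] shows the count modulo [m.+1]. *)
Lemma foldr_op_fun os i j m : i < S -> j < S -> m < L ->
  let st := foldr op_sem state0 os in
  foldr (op_fun I k) (point k i j 0 0 m 0) os =
  point k i j (st.1 i) (st.1 j) m (st.2 i j %% m.+1).
Proof.
move=> iS jS mL; elim: os => [|o os IH] /=; first by rewrite mod0n.
rewrite {}IH op_funE; set st := foldr _ _ _.
have cL : st.2 i j %% m.+1 < L by apply: leq_trans mL; apply: ltn_pmod.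
have ai := op_sem_lt3 os i; have aj := op_sem_lt3 os j.
rewrite pt_i_point // pt_j_point // pt_a_point // pt_b_point // pt_m_point //.
congr point; rewrite /new_c pt_i_point // pt_j_point // pt_a_point //.
rewrite pt_b_point // pt_m_point // pt_c_point //.
have -> : st.2 i j %% m.+1 <= m by rewrite -ltnS ltn_pmod.
rewrite andbT; case: ifP => _; last by rewrite addn0.
by rewrite -addn1 modnDml.
Qed.

(** * Unique decoding of the output *)

Lemma code_tableE n f : code_table n f = flatten (map code_nat [seq f x | x <- iota 0 n]).
Proof.
rewrite /code_table -map_comp; congr flatten; apply: eq_map => x /=.
by rewrite /code_nat; congr rcons; elim: (f x) => //= q ->.
Qed.

(** Numbers are prefix coded and each table has exactly [K] of them, so a word splits into tables in
    one way only. Hence any instance that the output encodes consists of the intended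
    permutations. *)
Lemma code_table_inj (h : 'S_K) f (s t : word) :
  code_perm h ++ s = code_table K f ++ t -> (forall x, h x = f x :> nat) /\ s = t.
Proof.
have -> : code_perm h = flatten (map code_nat [seq val (h i) | i <- enum 'I_K]).
  by rewrite /code_perm -map_comp.
rewrite code_tableE -val_enum_ord -(map_comp f) => /code_nats_inj[|E ->].
  by rewrite !size_map.
split=> // x; have := (eq_in_map _ _ _).2 E x; rewrite mem_enum; exact.
Qed.

Lemma code_tables_inj (gs : seq 'S_K) os (s t : word) : size gs = size os ->
  flatten [seq code_perm h | h <- gs] ++ s =
  flatten [seq code_table K (op_fun I k o) | o <- os] ++ t ->
  gs = map op_perm os /\ s = t.
Proof.
elim: gs os => [|h gs IH] [|o os] //= [szE].
rewrite -(catA (code_perm h)) -(catA (code_table _ _)) => /code_table_inj[hE].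
move=> /(IH _ szE)[-> ->]; split=> //; congr cons.
by apply/permP => x; apply: val_inj; rewrite /= hE permE.
Qed.

Lemma code_permE (h : 'S_K) f :
  (forall x, h x = f (val x) :> nat) -> code_perm h = code_table K f.
Proof.
move=> hf; rewrite code_tableE -val_enum_ord -(map_comp f) -(map_comp code_nat).
by congr flatten; apply: eq_map => x /=; rewrite hf.
Qed.

Lemma code_nat_map n : rcons (map (fun=> true) (nseq n false)) false = code_nat n.
Proof. by rewrite /code_nat map_nseq. Qed.

Lemma code_perms_ops os (g : 'S_K) f : (forall x, g x = f (val x) :> nat) ->
  code_perms (map op_perm os) g = code_nat (size os) ++
    flatten [seq code_table K (op_fun I k o) | o <- os] ++ code_table K f.
Proof.
move=> gf; rewrite /code_perms size_map -map_comp (code_permE gf).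
by do 3?congr (_ ++ _); congr flatten; apply: eq_map => o; apply: code_permE => x;
  apply: op_permE.
Qed.

Lemma subset_sum_codeE y : subset_sum_code I k y =
  code_nat (size (ops k (nbags I))) ++
  flatten [seq code_table K (op_fun I k o) | o <- ops k (nbags I)] ++
  code_table K (guessed k y).
Proof. by rewrite /subset_sum_code code_nat_map. Qed.

(** * Counters of a selection *)

Lemma subseq_cat_split (T : eqType) (s a b : seq T) : subseq s (a ++ b) ->
  exists s1 s2, [/\ s = s1 ++ s2, subseq s1 a & subseq s2 b].
Proof.
case/subseqP=> m szm ->.
exists (mask (take (size a) m) a), (mask (drop (size a) m) b).
rewrite !mask_subseq -{1}(cat_take_drop (size a) m) mask_cat //.
by rewrite size_takel // szm size_cat leq_addr.
Qed.

Lemma subseq_map_split (T U : eqType) (f : T -> U) s (t : seq T) :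
  subseq s (map f t) -> exists2 s', subseq s' t & s = map f s'.
Proof.
case/subseqP=> m szm ->; exists (mask m t); last by rewrite map_mask.
exact: mask_subseq.
Qed.

Lemma ops_succ r : ops k r.+1 = checks k r ++ turns k r ++ ops k r.
Proof. by rewrite /ops -addn1 iotaD rev_cat /= -catA. Qed.

Lemma mem_checks t o : (o \in checks k t) = [&& o.1 == t, o.2.1 < S & o.2.2 < S].
Proof.
case: o => t' [i j].
apply/flatten_mapP/and3P => [[i' hi /mapP[j' hj [-> -> ->]]]|].
  by move: hi hj; rewrite !mem_iota.
rewrite -[(t', (i, j)).1]/t'; case=> /eqP -> iS jS; exists i; first by rewrite mem_iota.
by apply/mapP; exists j; rewrite ?mem_iota.
Qed.

Lemma mem_turns t o : o \in turns k t -> (o.1 == t) && (o.2.2 == S).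
Proof. by case/flatten_mapP=> i _; rewrite !inE orbb => /eqP -> /=; rewrite !eqxx. Qed.

(** Each check is offered once per time, which limits every counter to one increment per time. *)
Lemma count_checks t o : count_mem o (checks k t) <= 1.
Proof.
rewrite count_uniq_mem ?leq_b1 //.
apply: (@allpairs_uniq _ _ _ (fun i j => (t, (i, j)))) (iota_uniq _ _) (iota_uniq _ _) _.
by move=> [i j] [i' j'] _ _ [-> ->].
Qed.

(** Rotations leave the counters alone and checks leave the colors alone, so the two blocks of one
    time can be analyzed separately. *)
Lemma foldr_turns t os st : subseq os (turns k t) ->
  (foldr op_sem st os).2 =2 st.2 /\
  forall i, ~~ recolored k t i -> (foldr op_sem st os).1 i = st.1 i.
Proof.
move=> /mem_subseq sub.
have {sub} : {in os, forall o, (o.1 == t) && (o.2.2 == S)}.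
  by move=> o /sub /mem_turns.
elim: os => //= o os IH H; have /andP[/eqP o1 /eqP o2] := H o (mem_head _ _).
have [|IH1 IH2] := IH; first by move=> o' o'os; apply: H; rewrite inE o'os orbT.
split=> [i j|i ri]; first by rewrite o2 ltnn addn0 IH1.
rewrite IH2 // /turned o1; case: eqP => [<-|_]; last by rewrite !andbF.
by rewrite (negbTE ri) andbF.
Qed.

Lemma foldr_checks t os st : subseq os (checks k t) ->
  (foldr op_sem st os).1 =1 st.1 /\
  forall i j, i < S -> j < S -> (foldr op_sem st os).2 i j =
    st.2 i j + (count_mem (t, (i, j)) os * compatible I k t i j (st.1 i) (st.1 j)).
Proof.
move=> /mem_subseq sub.
have {sub} : {in os, forall o, [&& o.1 == t, o.2.1 < S & o.2.2 < S]}.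
  by move=> o /sub; rewrite mem_checks.
elim: os => [|o os IH] H /=; first by split=> // i j _ _; rewrite mul0n addn0.
have /and3P[/eqP o1 oi oj] := H o (mem_head _ _).
have [|IH1 IH2] := IH; first by move=> o' o'os; apply: H; rewrite inE o'os orbT.
split=> [i|i j iS jS]; first by rewrite /turned leqNgt oj /= IH1.
rewrite IH2 // !IH1 oj /= mulnDl -addnA; congr (_ + _); rewrite addnC; congr (_ + _).
case: o {H oi oj} o1 => t' [i' j'] /= ->; rewrite !xpair_eqE eqxx /=.
rewrite (eq_sym i') (eq_sym j'); case: eqP => [->|] //=; case: eqP => [->|] //=.
by rewrite mul1n.
Qed.

(** A pair gains at most one per time, so a total of [r] forces its check to be selected and to
    succeed at every time. If this holds for all pairs, the colors form a run. *)
Lemma ops_sound r os : subseq os (ops k r) ->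
  let st := foldr op_sem state0 os in
  (forall i j, i < S -> j < S -> st.2 i j <= r) /\
  ((forall i j, i < S -> j < S -> st.2 i j = r) -> run I k r st.1).
Proof.
elim: r os => [|r IH] os.
  by rewrite subseq0 => /eqP->.
rewrite ops_succ => /subseq_cat_split[a [_ [-> sa /subseq_cat_split[b [os' [-> sb]]]]]].
move=> /IH; rewrite !foldr_cat; set st := foldr _ _ os' => -[IH1 IH2].
have [tb1 tb2] := foldr_turns st sb; set st' := foldr _ st b in tb1 tb2 *.
have [ca1 ca2] := foldr_checks st' sa; set st2 := foldr _ st' a in ca1 ca2 *.
have leC i j : count_mem (r, (i, j)) a * compatible I k r i j (st'.1 i) (st'.1 j) <= 1.
  have := leq_trans (leq_count_subseq (pred1 (r, (i, j))) sa) (count_checks _ _).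
  by case: compatible; rewrite ?muln0 ?muln1.
split=> [i j iS jS|E].
  by rewrite ca2 // tb1 -(addn1 r) leq_add ?IH1 ?leC.
have E' i j : i < S -> j < S -> st.2 i j = r /\ compatible I k r i j (st'.1 i) (st'.1 j).
  move=> iS jS; have := E i j iS jS; rewrite ca2 // tb1.
  have := IH1 i j iS jS; have := leC i j.
  move: (count_mem _ a) (st.2 i j) => c x.
  by case: compatible => /=; rewrite ?muln0 ?muln1 => *; split=> //; lia.
(* The selection from the earlier times gives a run of length [r], and the block of time [r] is its
   last step. *)
exists st.1; first by apply: IH2 => i j iS jS; case: (E' i j iS jS).
split=> [i iS|i iS|i j iS jS].
- by rewrite ca1; have := op_sem_lt3 (b ++ os') i; rewrite foldr_cat.
- by rewrite ca1; case: (boolP (recolored k r i)) => //= /tb2 ->.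
- by rewrite !ca1; case: (E' i j iS jS).
Qed.

Lemma iter_turn a b : a < 3 -> b < 3 -> exists2 d, d <= 2 & iter d (turn true) a = b.
Proof.
by case: a b => [|[|[|//]]] [|[|[|//]]] _ _;
  first [by exists 0 | by exists 1 | by exists 2].
Qed.

Lemma turns_complete t (st : state) (s : nat -> nat) :
  (forall i, st.1 i < 3) -> (forall i, i < S -> s i < 3) ->
  (forall i, i < S -> recolored k t i || (s i == st.1 i)) ->
  exists2 os, subseq os (turns k t) &
    forall i, i < S -> (foldr op_sem st os).1 i = s i.
Proof.
move=> st3 s3 sE; rewrite /turns.
(* Strengthened for induction over the list of slots: slots outside the list keep their colors. *)
suff [os sub osE] : exists2 os, subseq os (flatten
    [seq [:: (t, (i, S)); (t, (i, S))] | i <- iota 0 S]) &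
    forall i, (foldr op_sem st os).1 i = if i \in iota 0 S then s i else st.1 i.
  by exists os => // i iS; rewrite osE mem_iota iS.
have : {in iota 0 S, forall i, i < S} by move=> i; rewrite mem_iota.
elim: (iota 0 S) (iota_uniq 0 S) => [|n l IH] /=; first by exists [::].
move=> /andP[nl /IH{}IH] sub.
have [|os sub' osE] := IH; first by move=> i il; apply: sub; rewrite inE il orbT.
have nS : n < S := sub n (mem_head _ _).
(* [d] copies of the rotation of slot [n] are selected: two copies reach any of the three colors,
   and a slot that is not recolored takes none. *)
have [d d2 dE] : exists2 d, d <= 2 & iter d (turn (recolored k t n)) (st.1 n) = s n.
  have := sE n nS; case: recolored => /= [_|/eqP->]; last by exists 0.
  exact: iter_turn (st3 n) (s3 n nS).
exists (nseq d (t, (n, S)) ++ os).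
  apply: (@cat_subseq _ _ _ [:: (t, (n, S)); (t, (n, S))]) => //.
  by case: d d2 {dE} => [|[|[|d]]] // _; rewrite /= !eqxx.
move=> i; rewrite foldr_cat; set st' := foldr _ st os in osE *.
have -> : (foldr op_sem st' (nseq d (t, (n, S)))).1 i =
    iter d (turn (recolored k t n && (i == n))) (st'.1 i).
  by elim: (d) => //= d' IHd; rewrite /turned leqnn /= IHd.
rewrite inE osE; case: eqP => [->|_] /=; last first.
  by rewrite andbF; elim: (d) => //= d' ->.
by rewrite (negbTE nl) andbT.
Qed.

(** The rotations are selected so as to follow the run, and all checks are selected; compatibility
    along the run makes each of them succeed. *)
Lemma ops_complete r s : run I k r s -> exists2 os, subseq os (ops k r) &
  let st := foldr op_sem state0 os in
  (forall i, i < S -> st.1 i = s i) /\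
  (forall i j, i < S -> j < S -> st.2 i j = r).
Proof.
elim: r s => [|r IH] s /=.
  by move=> h; exists [::] => //=; split=> // i /h.
move=> [s0 /IH[os sub]]; set st := foldr _ _ os => -[E1 E2] [h1 h2 h3].
have [|b subb bE] := @turns_complete r st s (op_sem_lt3 os) h1.
  by move=> i iS; rewrite E1 ?h2.
have [tb _] := foldr_turns st subb; set st' := foldr _ st b in bE tb.
have [ca1 ca2] := foldr_checks st' (subseq_refl (checks k r)).
exists (checks k r ++ b ++ os).
  by rewrite ops_succ !cat_subseq.
rewrite (foldr_cat _ _ (checks k r)) (foldr_cat _ _ b) -/st -/st'; cbv zeta.
split=> [i iS|i j iS jS]; first by rewrite ca1 bE.
rewrite ca2 // tb E2 // !bE // h3 // muln1 -addn1; congr (_ + _).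
apply/eqP; rewrite eqn_leq count_checks -has_count has_pred1 mem_checks /=.
by rewrite eqxx iS.
Qed.

(** * Equivalence of subset sum and runs *)

Lemma counters_okP y : reflect
  (forall i j m, i < S -> j < S -> m < L ->
    pt_c k (guessed k y (point k i j 0 0 m 0)) = nbags I %% m.+1)
  (counters_ok I k y).
Proof.
apply: (iffP allP) => [H i j m iS jS mL | H i].
  have /H/allP/(_ j)/[!mem_iota]/(_ jS)/allP/(_ m) : i \in iota 0 S by rewrite mem_iota.
  by rewrite mem_iota => /(_ mL)/eqP.
rewrite mem_iota => /andP[_ iS]; apply/allP => j; rewrite mem_iota => /andP[_ jS].
apply/allP => m; rewrite mem_iota => /andP[_ mL]; apply/eqP; exact: H.
Qed.

Lemma start_lt i j m : i < S -> j < S -> m < L -> point k i j 0 0 m 0 < K.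
Proof. by move=> *; apply: point_lt; rewrite ?ncycles_gt0. Qed.

(** Unique decoding identifies the target with the guessed permutation, whose verified entries give
    every count modulo all cycle lengths. This determines the counts, and [ops_sound] turns them
    into a run. *)
Lemma group_sound y : size I < 3 ^ S -> counters_ok I k y ->
  group_subset_sum (subset_sum_code I k y) K -> exists s, run I k (nbags I) s.
Proof.
move=> szI /counters_okP ok [gs [g [/esym]]].
rewrite subset_sum_codeE => /code_nat_inj[szE] /(code_tables_inj szE)[-> /esym E].
have [gE _] : (forall x, g x = guessed k y x :> nat) /\ [::] = [::] :> word.
  by apply: code_table_inj; rewrite !cats0.
case=> _ /subseq_map_split[os sub ->] prod; have [Cle] := ops_sound sub.
set st := foldr _ _ os in Cle *; move=> h; exists st.1; apply: h => i j iS jS.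
(* The number of bags is at most [size I], which is below 3^S and thus below 4^S. *)
have rS : nbags I < 2 ^ (2 * S).
  apply: leq_ltn_trans (find_size _ _) _; rewrite size_drop.
  apply: leq_ltn_trans (leq_subr _ _) (leq_trans szI _).
  by rewrite expnM leq_exp2r ?nslots_gt0.
(* The moduli up to twice [2 * S] are exactly the cycle lengths up to [L]. *)
apply: (@eq_of_mods (2 * S)) => // [|m mL].
  by apply: leq_ltn_trans (Cle _ _ iS jS) rS.
have {}mL : m < L by rewrite /ncycles -[4]/(2 * 2) -mulnA mul2n.
have := ok i j m iS jS mL; rewrite -(gE (Ordinal (start_lt iS jS mL))) -prod.
rewrite perm_comp_seq_ops foldr_op_fun // pt_c_point //.
by apply: leq_trans mL; apply: ltn_pmod.
Qed.

(** The right guess is the matrix of the product of the operations selected along the run. *)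
Lemma group_complete s N : run I k (nbags I) s -> K * K <= N ->
  exists2 y : N.-tuple bool, counters_ok I k y &
    group_subset_sum (subset_sum_code I k y) K.
Proof.
move=> /ops_complete[os sub]; set st := foldr _ _ os => -[_ CE] KN.
pose f x := foldr (op_fun I k) x os.
have f_lt x : x < K -> f x < K.
  by move=> xK; rewrite /f; elim: (os) => //= o l; apply: op_fun_lt.
(* Row-major order, with the one of row [x] in column [f x]; [KN] leaves room for all rows. *)
pose y := mkseq (fun n => n %% K == f (n %/ K)) N.
have y_tuple : size y == N by rewrite size_mkseq.
have K0 : 0 < K := leq_ltn_trans (leq0n _) (start_lt nslots_gt0 nslots_gt0 ncycles_gt0).
have yE x : x < K -> guessed k y x = f x.
  move=> xK; rewrite /guessed (@eq_in_find _ _ (pred1 (f x))) => [|z].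
    have := @index_uniq _ 0 (f x) (iota 0 K).
    by rewrite size_iota nth_iota ?f_lt // iota_uniq; exact.
  rewrite mem_iota => /andP[_ zK]; rewrite nth_mkseq; last first.
    by apply: leq_trans KN; have := leq_mul xK (leqnn K); rewrite mulSn; lia.
  by rewrite modnMDl modn_small // divnMDl // divn_small // addn0.
exists (Tuple y_tuple).
  apply/counters_okP => i j m iS jS mL; rewrite yE ?start_lt // /f.
  rewrite foldr_op_fun // pt_c_point // ?CE //.
  by apply: leq_trans mL; apply: ltn_pmod.
exists (map op_perm (ops k (nbags I))), (perm_comp_seq (map op_perm os)); split.
  rewrite subset_sum_codeE (@code_perms_ops _ _ (guessed k y)) // => x.
  by rewrite perm_comp_seq_ops yE ?ltn_ord.
by exists (map op_perm os) => //; apply: map_subseq.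
Qed.

End Group.

(** * Colorings and runs *)

Definition colorable (I : word) : Prop :=
  exists c : nat -> nat, (forall v, v < nvert I -> c v < 3) /\
    forall u v, u < nvert I -> v < nvert I -> edge I u v -> c u != c v.

Section Coloring.

Variables (I : word) (k : nat).

Local Notation n := (nvert I).
Local Notation r := (nbags I).

Record valid_spec : Prop := ValidSpec {
  valid_size : size I = bags_pos I + r.+1 + r * n;
  valid_irr : forall u, u < n -> ~~ edge I u u;
  valid_sym : forall u v, u < n -> v < n -> edge I u v -> edge I v u;
  valid_interval : forall v, v < n -> exists a b, a <= b < r /\
    forall i, i < r -> in_bag I i v = (a <= i <= b);
  valid_cover : forall u v, u < n -> v < n -> edge I u v ->
    exists2 t, t < r & in_bag I t u && in_bag I t v;
  valid_width : forall t, t < r -> count (in_bag I t) (iota 0 n) <= k.+1 }.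

Lemma all_iotaP m (P : nat -> bool) :
  reflect (forall i, i < m -> P i) (all P (iota 0 m)).
Proof.
apply: (iffP allP) => H i; last by rewrite mem_iota => /H.
by move=> im; apply: H; rewrite mem_iota.
Qed.

Lemma has_iotaP m (P : nat -> bool) :
  reflect (exists2 i, i < m & P i) (has P (iota 0 m)).
Proof.
by apply: (iffP hasP) => -[i im Pi]; exists i => //; move: im; rewrite mem_iota.
Qed.

Lemma validP : reflect valid_spec (valid I k).
Proof.
apply: (iffP and5P) => [[/eqP h1 /all_iotaP h2 /all_iotaP h3 /all_iotaP h4]|].
  case/andP=> /all_iotaP h5 /all_iotaP h6; split=> //.
- by move=> u v un vn; apply/implyP; have /all_iotaP := h3 u un; apply.
- move=> v /h4/has_iotaP[a ar /has_iotaP[b br /andP[ab /all_iotaP H]]].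
  by exists a, b; rewrite ab br; split=> // i /H/eqP.
- move=> u v un vn e; have /all_iotaP/(_ v vn)/implyP/(_ e)/has_iotaP := h5 u un.
  exact.
case=> h1 h2 h3 h4 h5 h6; split; [exact/eqP | | | | apply/andP; split];
  apply/all_iotaP => //.
- by move=> u un; apply/all_iotaP => v vn; apply/implyP; apply: h3.
- move=> v /h4[a [b [/andP[ab br] H]]]; apply/has_iotaP; exists a.
    exact: leq_ltn_trans ab br.
  apply/has_iotaP; exists b => //; rewrite ab; apply/all_iotaP => i /H ->; exact: eqxx.
- by move=> u un; apply/all_iotaP => v vn; apply/implyP => e; apply/has_iotaP; apply: h5.
Qed.

Lemma count_iota_lt (P : pred nat) u v : u < v -> P u ->
  count P (iota 0 u) < count P (iota 0 v).
Proof.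
move=> uv Pu; have -> : v = u + (1 + (v - u.+1)) by lia.
by rewrite iotaD count_cat /= Pu -addn1 leq_add2l.
Qed.

(** The number of smaller bag members strictly grows from one member of the bag to a later one. *)
Lemma has_rank_inj t i u v : has_rank I t i u -> has_rank I t i v -> u = v.
Proof.
wlog uv : u v / u <= v => [wl|].
  by case: (leqP u v) => [/wl|/ltnW/wl h hu hv]; [exact | apply/esym/h].
move=> /andP[tu /eqP cu] /andP[tv /eqP cv]; apply/eqP; rewrite eqn_leq uv /=.
case: leqP => // /(count_iota_lt (P := in_bag I t)) /(_ tu).
by rewrite cu cv ltnn.
Qed.

Lemma compatibleP t i j a b : reflect
  (forall u v, u < n -> v < n -> holds I k t i u -> holds I k t j v ->
     (u = v -> a = b) /\ (edge I u v -> a != b))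
  (compatible I k t i j a b).
Proof.
apply: (iffP (all_iotaP _ _)) => H u.
  move=> v un vn iu jv; have /all_iotaP/(_ v vn) := H u un; rewrite iu jv /=.
  by case/andP=> /implyP h1 /implyP h2; split=> // /eqP /h1 /eqP.
move=> un; apply/all_iotaP => v vn; apply/implyP => /andP[iu jv].
have [h1 h2] := H u v un vn iu jv; apply/andP; split; apply/implyP => //.
by move=> /eqP /h1 ->.
Qed.

(** At time 0 both banks carry bag 0, so [t] is a successor; by parity the slot then lies in the
    bank that was current at time [t']. *)
Lemma not_recolored t i : i < nslots k -> ~~ recolored k t i ->
  exists t', [/\ t = t'.+1, i %/ k.+1 = t' %% 2 & i %/ k.+1 != t %% 2].
Proof.
rewrite /recolored /slot_bag => iS; case: ifP => [_|ne]; first by rewrite eqxx.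
case: t ne => // t ne _; exists t; split=> //.
have : i %/ k.+1 < 2 by rewrite ltn_divLR.
by move: ne; rewrite !modn2 /=; case: (odd t); case: (_ %/ _) => [|[|q]].
Qed.

(** Every slot takes the color of the vertex that it carries, and color 0 if it is empty. *)
Lemma coloring_run : colorable I -> exists s, run I k r s.
Proof.
move=> [c [c3 cE]].
pose vert t i := find (has_rank I t i) (iota 0 n).
pose col t i := if vert t i < n then c (vert t i) else 0.
pose st t i := col (slot_bag k t i) (i %% k.+1).
have col3 t i : col t i < 3 by rewrite /col; case: ifP => // /c3.
have stE t i u : u < n -> holds I k t i u -> st t i = c u.
  move=> un hu; rewrite /st /col.
  have hasu : has (has_rank I (slot_bag k t i) (i %% k.+1)) (iota 0 n).
    by apply/has_iotaP; exists u.
  have vn : vert (slot_bag k t i) (i %% k.+1) < n.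
    by have := hasu; rewrite has_find size_iota.
  rewrite vn; congr c; apply: has_rank_inj hu.
  by have := nth_find 0 hasu; rewrite nth_iota // add0n.
(* [st t] is the coloring after time [t]; before time 0 all colors are 0. *)
exists (if r is t.+1 then st t else fun=> 0); elim: r => // t IH.
exists (if t is t'.+1 then st t' else fun=> 0) => //; split.
- by move=> i _; apply: col3.
- move=> i iS; case: (boolP (recolored k t i)) => //= /(not_recolored iS).
  (* The slot carries bag [t'] at both times, hence the same vertex, if any, and the same color. *)
  by move=> [t' [-> it' it]]; rewrite /st /slot_bag (negbTE it) it' eqxx.
- move=> i j iS jS; apply/compatibleP => u v un vn iu jv.
  rewrite (stE t i u) // (stE t j v) //; split=> [->|] //; exact: cE.
Qed.

(** Unfolds the nested existentials into one sequence, in which [sg t'] is the coloring before time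
    [t']. *)
Lemma run_seq t s : run I k t s -> exists sg : nat -> nat -> nat,
  sg t = s /\ forall t', t' < t -> step I k t' (sg t') (sg t'.+1).
Proof.
elim: t s => [|t IH] s /=; first by exists (fun=> s).
move=> [s0 /IH[sg [E H]] st]; exists (fun t' => if t' == t.+1 then s else sg t').
rewrite eqxx; split=> // t'; rewrite ltnS eqSS => t't; rewrite ltn_eqF ?ltnS //.
by case: eqP => [->|/eqP ne]; rewrite ?E //; apply: H; rewrite ltn_neqAle ne.
Qed.

(** The width bound makes every rank fit into a bank. The color of a vertex is read in its first
    bag; equality checks carry it through the interval of its bags, and an edge is checked in a bag
    that covers it. *)
Lemma run_coloring s : valid_spec -> run I k r s -> colorable I.
Proof.
move=> V /run_seq[sg [_ H]].
pose rank t v := count (in_bag I t) (iota 0 v).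
pose slot t v := (t %% 2) * k.+1 + rank t v.
have rank_lt t v : t < r -> v < n -> in_bag I t v -> rank t v < k.+1.
  move=> tr vn tv; apply: leq_trans (valid_width V tr).
  exact: count_iota_lt.
have slot_div t v : t < r -> v < n -> in_bag I t v -> slot t v %/ k.+1 = t %% 2.
  by move=> tr vn tv; rewrite divnMDl // divn_small ?addn0 // rank_lt.
have slot_lt t v : t < r -> v < n -> in_bag I t v -> slot t v < nslots k.
  move=> tr vn tv; have := rank_lt t v tr vn tv; rewrite /slot /nslots.
  by rewrite modn2; case: odd => /=; lia.
have holds_rank t t' v : t' < r -> v < n -> in_bag I t' v ->
    slot_bag k t (slot t' v) = t' -> holds I k t (slot t' v) v.
  move=> tr vn tv E; rewrite /holds E /has_rank tv /slot modnMDl.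
  by rewrite modn_small ?eqxx // rank_lt.
have bag_now t v : t < r -> v < n -> in_bag I t v -> slot_bag k t (slot t v) = t.
  by move=> *; rewrite /slot_bag slot_div // eqxx.
have bag_next t v : t < r -> v < n -> in_bag I t v -> slot_bag k t.+1 (slot t v) = t.
  by move=> *; rewrite /slot_bag slot_div // !modn2 /=; case: odd.
(* The coloring after time [t], when the bank of bag [t] has just been recolored. *)
pose col t v := sg t.+1 (slot t v).
(* At time [t.+1] the old slot of [v] is not recolored, and the check against its new slot forces
   equal colors. *)
have col_next t v : t.+1 < r -> v < n -> in_bag I t v -> in_bag I t.+1 v ->
    col t.+1 v = col t v.
  move=> tr vn tv tv'; have [_ h2 h3] := H _ tr; have tr' := ltnW tr.
  have /compatibleP/(_ v v vn vn) :=
    h3 _ _ (slot_lt _ _ tr vn tv') (slot_lt _ _ tr' vn tv).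
  rewrite !holds_rank ?bag_now ?bag_next // => /(_ isT isT)[/(_ erefl) e1 _].
  have := h2 _ (slot_lt _ _ tr' vn tv); rewrite /recolored bag_next //.
  by rewrite ltn_eqF //= -e1 => /eqP.
(* The bags of [v] form an interval from [a] to [b], so both colors are propagated from bag [a]. *)
have col_eq t t' v : t < r -> t' < r -> v < n -> in_bag I t v -> in_bag I t' v ->
    col t v = col t' v.
  move=> tr t'r vn; have [a [b [/andP[ab br] iE]]] := valid_interval V vn.
  rewrite !iE // => /andP[at_ tb] /andP[at' tb'].
  have colE d : a + d <= b -> col (a + d) v = col a v.
    elim: d => [|d IH] ad; first by rewrite addn0.
    rewrite addnS in ad *; rewrite col_next ?IH ?iE //; try lia.
  by rewrite -(subnKC at_) -(subnKC at') !colE ?subnKC.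
pose fst_bag v := find (fun t => in_bag I t v) (iota 0 r).
have fstE v : v < n -> fst_bag v < r /\ in_bag I (fst_bag v) v.
  move=> vn; have [a [b [/andP[ab br] iE]]] := valid_interval V vn.
  have h : has (fun t => in_bag I t v) (iota 0 r).
    by apply/has_iotaP; exists a; rewrite ?iE ?leqnn //; apply: leq_ltn_trans br.
  have fr : fst_bag v < r by have := h; rewrite has_find size_iota.
  by split=> //; have := nth_find 0 h; rewrite nth_iota.
exists (fun v => col (fst_bag v) v); split=> [v vn|u v un vn e].
  have [fr fv] := fstE v vn; have [h1 _ _] := H _ fr.
  by apply: h1; apply: slot_lt.
have [t tr /andP[tu tv]] := valid_cover V un vn e.
have [fur fu] := fstE u un; have [fvr fv] := fstE v vn.
rewrite (col_eq _ t u) // (col_eq _ t v) //.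
have [_ _ h3] := H _ tr.
have /compatibleP/(_ u v un vn) := h3 _ _ (slot_lt _ _ tr un tu) (slot_lt _ _ tr vn tv).
by rewrite !holds_rank ?bag_now // => /(_ isT isT)[_]; apply.
Qed.

End Coloring.

(** * Decoding the graph *)

Lemma nth_allpairs (S T R : Type) (f : S -> T -> R) (s : seq S) (t : seq T)
    r0 x0 y0 m i j : size t = m -> i < size s -> j < m ->
  nth r0 [seq f x y | x <- s, y <- t] (i * m + j) = f (nth x0 s i) (nth y0 t j).
Proof.
move=> <-; elim: s i => //= x s IH [|i] i_s jt; rewrite nth_cat size_map.
  by rewrite mul0n add0n jt (nth_map y0).
by rewrite mulSn -addnA ltnNge leq_addr /= addKn IH.
Qed.

Section Decode.

Variables (n : nat) (e : rel 'I_n) (Xs : seq {set 'I_n}).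

Let I := code_graph_bags e Xs.

Lemma size_edges : size [seq e u v | u <- enum 'I_n, v <- enum 'I_n] = n * n.
Proof. by rewrite size_allpairs size_enum_ord. Qed.

Lemma size_bags :
  size [seq v \in X | X : {set 'I_n} <- Xs, v : 'I_n <- enum 'I_n] = size Xs * n.
Proof. by rewrite size_allpairs size_enum_ord. Qed.

Lemma size_code_nat m : size (code_nat m) = m.+1.
Proof. by rewrite size_rcons size_nseq. Qed.

Lemma nvert_code : nvert I = n.
Proof. exact: find_code_nat. Qed.

Lemma bags_pos_code : bags_pos I = n.+1 + n * n.
Proof. by rewrite /bags_pos nvert_code. Qed.

Lemma nbags_code : nbags I = size Xs.
Proof.
rewrite /nbags bags_pos_code /I /code_graph_bags catA drop_size_cat ?find_code_nat //.
by rewrite size_cat size_code_nat size_edges.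
Qed.

Lemma size_code : size I = bags_pos I + (nbags I).+1 + nbags I * nvert I.
Proof.
rewrite nbags_code bags_pos_code nvert_code /I /code_graph_bags !size_cat.
by rewrite !size_code_nat size_edges size_bags !addnA.
Qed.

Lemma edge_code (u v : 'I_n) : edge I u v = e u v.
Proof.
rewrite /edge nvert_code /I /code_graph_bags nth_cat size_code_nat -addnA.
rewrite ltnNge leq_addr /= addKn nth_cat size_edges.
have uvn : u * n + v < n * n by have := ltn_ord u; have := ltn_ord v; nia.
rewrite uvn (nth_allpairs _ _ u u) ?size_enum_ord //.
by rewrite !nth_ord_enum.
Qed.

Lemma in_bag_code t (v : 'I_n) : t < size Xs -> in_bag I t v = (v \in nth set0 Xs t).
Proof.
move=> tr; rewrite /in_bag bags_pos_code nbags_code nvert_code /I /code_graph_bags.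
rewrite -!addnA nth_cat size_code_nat ltnNge leq_addr /= addKn.
rewrite nth_cat size_edges ltnNge leq_addr /= addKn.
rewrite nth_cat size_code_nat ltnNge leq_addr /= addKn.
by rewrite (nth_allpairs (fun (X : {set 'I_n}) v => v \in X) _ set0 v)
  ?size_enum_ord // nth_ord_enum.
Qed.

Lemma card_bag_code t : t < size Xs ->
  count (in_bag I t) (iota 0 n) = #|nth set0 Xs t|.
Proof.
move=> tr; rewrite -val_enum_ord count_map -sum1_count -sum1_card big_enum_cond.
by apply: eq_bigl => v; rewrite /= in_bag_code.
Qed.

Lemma valid_code k : valid I k <->
  [/\ simple_graph e, path_decomposition e Xs & width Xs <= k].
Proof.
have nE := nvert_code; have rE := nbags_code; split.
  move=> /validP[_ h2 h3 h4 h5 h6]; rewrite nE rE in h2 h3 h4 h5 h6; split.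
  - split=> [u v|u]; last by have := h2 u (ltn_ord u); rewrite edge_code => /negbTE.
    have h := h3 _ _ (ltn_ord u) (ltn_ord v); have h' := h3 _ _ (ltn_ord v) (ltn_ord u).
    rewrite !edge_code in h h'.
    by case: (e u v) (e v u) h h' => -[] // => [/(_ isT)|_ /(_ isT)].
  - split=> [v|u v euv].
      have [a [b [/andP[ab br] H]]] := h4 v (ltn_ord v); exists a, b; rewrite ab br.
      by split=> // i ir; rewrite -in_bag_code // H.
    have := h5 _ _ (ltn_ord u) (ltn_ord v); rewrite edge_code => /(_ euv)[t tr].
    by rewrite !in_bag_code // => tuv; exists (nth set0 Xs t) => //; apply: mem_nth.
  (* Truncation is harmless: max - 1 is at most k iff max is at most k + 1. *)
  - rewrite /width leq_subLR add1n; apply/bigmax_leqP_seq => X XXs _.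
    have := h6 _ (_ : index X Xs < size Xs); rewrite index_mem => /(_ XXs).
    by rewrite card_bag_code ?index_mem // nth_index.
move=> [[sym irr] [pd cov] w]; apply/validP; split; rewrite ?nE ?rE.
- by rewrite size_code nE rE.
- by move=> u un; rewrite (edge_code (Ordinal un) (Ordinal un)) irr.
- move=> u v un vn; rewrite (edge_code (Ordinal un) (Ordinal vn)).
  by rewrite (edge_code (Ordinal vn) (Ordinal un)) sym.
- move=> v vn; have [a [b [ab H]]] := pd (Ordinal vn); exists a, b; split=> // i ir.
  by rewrite -H // (in_bag_code (Ordinal vn)).
- move=> u v un vn; rewrite (edge_code (Ordinal un) (Ordinal vn)) => /cov[X XXs uvX].
  exists (index X Xs); first by rewrite index_mem.
  rewrite (in_bag_code (Ordinal un)) ?(in_bag_code (Ordinal vn)) ?index_mem //.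
  by rewrite nth_index.
- move=> t tr; rewrite card_bag_code //; move: w; rewrite /width leq_subLR add1n.
  by move=> /bigmax_leqP_seq; apply=> //; apply: mem_nth.
Qed.

Lemma colorable_code : colorable I <-> three_colorable e.
Proof.
rewrite /colorable nvert_code; split=> [[c [c3 cE]]|[c cE]].
  exists (fun v => inord (c v)) => u v; rewrite -edge_code => euv.
  apply: contra_neq (cE u v (ltn_ord u) (ltn_ord v) euv).
  move=> /(congr1 val); rewrite /= !inordK ?c3 //; exact.
exists (fun v => if insub v is Some v' then val (c v') else 0); split=> [v vn|u v un vn].
  by rewrite insubT /= ltn_ord.
rewrite !insubT /= => euv; apply: contra_neq (cE (Ordinal un) (Ordinal vn) _).
  by move=> /val_inj.
by rewrite -edge_code.
Qed.

End Decode.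

Lemma bits_allpairs (S T : Type) (s : seq S) (t : seq T) (f : S -> T -> bool)
    x0 y0 (w : word) m : size t = m -> size w = size s * m ->
  (forall i j, i < size s -> j < m ->
     f (nth x0 s i) (nth y0 t j) = nth false w (i * m + j)) ->
  [seq f x y | x <- s, y <- t] = w.
Proof.
move=> tm ws H; apply: (@eq_from_nth _ false) => [|q]; rewrite size_allpairs tm ?ws //.
case: (posnP m) => [-> | m0]; first by rewrite muln0.
move=> qs; rewrite (divn_eq q m) (nth_allpairs _ _ x0 y0 tm) ?H ?ltn_pmod //.
all: by rewrite ltn_divLR.
Qed.

Lemma code_nat_find (w : word) :
  find negb w < size w -> w = code_nat (find negb w) ++ drop (find negb w).+1 w.
Proof.
elim: w => // -[] w IH /=; last by rewrite drop0.
by rewrite ltnS => /IH e; rewrite {1}e.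
Qed.

(** A valid word is the code of the graph and the bags read off from it, so an arbitrary input is
    decided by inspecting its bits. *)
Lemma three_coloring_pwP I k : three_coloring_pw I k <-> valid I k /\ colorable I.
Proof.
split=> [[n [e [Xs [-> h1 h2 h3 h4]]]]|[V C]].
  by split; [apply/valid_code | apply/colorable_code].
pose n := nvert I; pose e : rel 'I_n := fun u v => edge I u v.
pose Xs := [seq [set v : 'I_n | in_bag I t v] | t <- iota 0 (nbags I)].
suff IE : I = code_graph_bags e Xs.
  exists n, e, Xs; move: V C; rewrite IE => /valid_code[h1 h2 h3] /colorable_code h4.
  by split.
have [szI _ _ _ _ _] := validP _ _ V.
pose w := drop (bags_pos I) I.
have wE : w = code_nat (nbags I) ++ drop (nbags I).+1 w.
  apply: code_nat_find; rewrite -/(nbags I) size_drop szI -addnA addKn; lia.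
have vE : drop n.+1 I = take (n * n) (drop n.+1 I) ++ w.
  by rewrite /w /bags_pos addnC -drop_drop cat_take_drop.
rewrite {1}(@code_nat_find I) -/(nvert I); last by rewrite szI /bags_pos; lia.
rewrite /code_graph_bags -/n vE wE size_map size_iota; congr (_ ++ (_ ++ (_ ++ _))).
  (* Without vertices ['I_n] offers no default for [nth], but then both words are empty. *)
  apply/esym; have [n0|n0] := posnP n.
    rewrite [RHS]size0nil; last by rewrite n0 take0.
    by apply: size0nil; rewrite size_allpairs !size_enum_ord n0.
  pose x0 := Ordinal n0.
  apply: (@bits_allpairs _ _ _ _ _ x0 x0 _ n); rewrite ?size_enum_ord //.
    by rewrite size_takel // size_drop szI /bags_pos; lia.
  move=> i j i_n j_n; rewrite /e nth_take; last by nia.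
  by rewrite nth_drop addnA !nth_enum_ord.
have szw : size (drop (nbags I).+1 w) = nbags I * n.
  by rewrite !size_drop szI -/n; lia.
apply/esym; have [n0|n0] := posnP n.
  rewrite [RHS]size0nil; last by rewrite szw n0 muln0.
  by apply: size0nil; rewrite size_allpairs size_enum_ord [X in _ * X]n0 muln0.
apply: (@bits_allpairs _ _ _ _ _ set0 (Ordinal n0) _ n).
- exact: size_enum_ord.
- by rewrite size_map size_iota.
move=> i j; rewrite size_map size_iota => i_r j_n.
rewrite (nth_map 0) ?size_iota // nth_iota // add0n inE nth_enum_ord //.
by rewrite /in_bag !nth_drop !addnA.
Qed.

(** * Correctness *)

Lemma yes_instanceP : group_subset_sum yes_instance.1 yes_instance.2.
Proof.
exists [::], 1%g; split; last by exists [::].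
by rewrite /code_perms /code_perm (size0nil (size_enum_ord 0)).
Qed.

Lemma no_instanceP : ~ group_subset_sum no_instance.1 no_instance.2.
Proof. by move=> [[|h gs] [g []]]. Qed.

Definition degree_poly : {poly nat} :=
  let s : {poly nat} := (2%N%:P * ('X + 1%N%:P))%R in
  (s * s * 3%N%:P * 3%N%:P * (4%N%:P * s) * (4%N%:P * s))%R.

Lemma degree_polyE k : degree_poly.[k]%R = degree k.
Proof.
rewrite /degree_poly !(hornerM, hornerD, hornerX, hornerC).
by rewrite /degree /ncycles /nslots -[k.+1]addn1.
Qed.

Lemma reductionE I k y : reduction (I, (k, y)) =
  if ~~ valid I k then no_instance
  else if 3 ^ nslots k <= size I then
    if has (fun=> true) (reachable I k) then yes_instance else no_instance
  else if counters_ok I k y then (subset_sum_code I k y, degree k)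
  else no_instance.
Proof. by rewrite -iter_div3_gt0. Qed.

Lemma reduction_param I k y : (reduction (I, (k, y))).2 <= degree k * degree k.
Proof.
rewrite reductionE; case: ifP => // _; case: ifP => _; first by case: ifP.
by case: ifP => //= _; rewrite leq_pmulr.
Qed.

Lemma reduction_complete I k N : degree k * degree k <= N -> three_coloring_pw I k ->
  exists y : N.-tuple bool,
    group_subset_sum (reduction (I, (k, tval y))).1 (reduction (I, (k, tval y))).2.
Proof.
move=> KN /three_coloring_pwP[V /(@coloring_run _ k)[s rs]].
case: (leqP (3 ^ nslots k) (size I)) => szI.
  exists (nseq_tuple N false); rewrite reductionE V szI.
  by rewrite (introT (reachableP szI)) //; [apply: yes_instanceP | exists s].
have [y ok Qy] := group_complete rs KN; exists y.
by rewrite reductionE V leqNgt szI ok.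
Qed.

Lemma reduction_sound I k y :
  group_subset_sum (reduction (I, (k, y))).1 (reduction (I, (k, y))).2 ->
  three_coloring_pw I k.
Proof.
rewrite reductionE => H; apply/three_coloring_pwP; move: H.
case: (validP I k) => [V | _ /no_instanceP //]; rewrite [~~ _]/=.
case: leqP => szI.
  case: reachableP => // [[s rs] _|_ /no_instanceP //].
  by split=> //; apply: run_coloring rs.
case: ifP => [ok /(group_sound szI ok)[s rs]|_ /no_instanceP //].
by split=> //; apply: run_coloring rs.
Qed.

(** * Running the reduction as a program *)

Lemma tree_of_word_inj : injective tree_of_word.
Proof. by elim=> [|[] w IH] [|[] w'] //= [] /IH ->. Qed.

Lemma tree_of_nat_inj : injective tree_of_nat.
Proof. by elim=> [|m IH] [|n] //= [] /IH ->. Qed.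

Lemma sz_word (w : word) : sz w <= 4 * size w + 1.
Proof.
elim: w => // b w IH; rewrite sz_cons /=; have := sz_bool b; lia.
Qed.

Lemma ptime_program (f : word * (nat * word) -> word * nat) (p : {poly nat}) :
  ptime f -> exists B (q : {poly nat}), forall I k y, size y <= p.[k]%R ->
    exists2 t, t <= q.[(size I + k)%N]%R &
      runs B I k y t (f (I, (k, y))).1 (f (I, (k, y))).2.
Proof.
move=> pf; have psz := pb_sz_ptime pf; case: pf => c [N [tm [ptm H]]].
have [T TE] : poly_bounded (fun z : word * (nat * word) =>
    tm z + 10 * (sz z + sz (f z)) + 20).
  by pb.
exists (Seq (Assign 0 (Cons (Var 0) (Cons (Var 1) (Var 2))))
  (Seq c (Seq (Assign 1 (Tl (Var 0))) (Assign 0 (Hd (Var 0)))))).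
(* The inner polynomial bounds the encoded input: a word of length l has size at most 4 l + 1, the
   number [k] has size 2 k + 1, and by monotonicity [p] may be evaluated at [size I + k]. *)
exists (T \Po (4%N%:P * 'X + 4%N%:P * p + 10%N%:P))%R => I k y szy.
suff [t [s [E [s0 s1 tle]]]] : wp (Seq (Assign 0 (Cons (Var 0) (Cons (Var 1) (Var 2))))
  (Seq c (Seq (Assign 1 (Tl (Var 0))) (Assign 0 (Hd (Var 0)))))) (init_store I k y)
  (fun t s => [/\ s 0 = tree_of_word (f (I, (k, y))).1,
    s 1 = tree_of_nat (f (I, (k, y))).2 & t <= T.[sz (I, (k, y))]%R]).
  exists t; last by exists s.
  apply: leq_trans tle _; rewrite horner_comp; apply: horner_mono.
  rewrite !(hornerM, hornerD, hornerX, hornerC) !sz_pair /= sz_nat.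
  have := sz_word I; have := sz_word y; have := horner_mono p (leq_addl (size I) k).
  move=> h1 h2 h3; rewrite -mul2n.
  have := leq_trans szy h1; move: (p.[_]%R) => m h4.
  by change (sz I + ((2 * k).+1 + sz y).+1 < 4 * (size I + k) + 4 * m + 10); lia.
apply: wp_seq; apply: wp_assign; apply: wp_seq.
set s1 := update _ _ _; have s10 : s1 0 = enc (I, (k, y)) by [].
apply: wp_mono (H s1 _ s10) => t2 s2 [s20 tle _]; apply: wp_seq.
apply: wp_assign => /=; apply: wp_assign => /=.
rewrite /update /= s20; split=> //.
apply: leq_trans (TE _).
have -> : tree_size (init_store I k y 0) = sz I by [].
have -> : tree_size (init_store I k y 1) = sz k by [].
have -> : tree_size (init_store I k y 2) = sz y by [].
case: (f _) => I' k'; apply: leq_trans (leq_add (leq_add tle (leqnn _)) (leqnn _)).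
by rewrite !sz_pair /= -!/(sz _); lia.
Qed.

Theorem theorem5 : has_nppt three_coloring_pw group_subset_sum.
Proof.
(* A guess of this length holds a permutation matrix, and the value also bounds the output parameter
   [degree k]. *)
pose p : {poly nat} := (degree_poly * degree_poly)%R.
have pE k : p.[k]%R = degree k * degree k by rewrite /p hornerM degree_polyE.
have [B [q Bq]] := ptime_program p ptime_reduction.
(* Determinism of execution and injectivity of the encodings make the output of every run that of
   [reduction]. *)
have Bdet I k (y : (p.[k]%R).-tuple bool) t I' k' : runs B I k y t I' k' ->
    I' = (reduction (I, (k, tval y))).1 /\ k' = (reduction (I, (k, tval y))).2.
  move=> [s [E s0 s1]]; have [t' _ [s' [E' s0' s1']]] := Bq I k y (eq_leq (size_tuple y)).
  have [_ ss'] := exec_det E E'; rewrite ss' in s0 s1.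
  split; first by apply: tree_of_word_inj; rewrite -s0 -s0'.
  by apply: tree_of_nat_inj; rewrite -s1 -s1'.
exists B, p; split.
- exists q => I k y; have [t tq R] := Bq I k y (eq_leq (size_tuple y)).
  exists t, (reduction (I, (k, tval y))).1, (reduction (I, (k, tval y))).2; split=> //.
  by apply: leq_trans (reduction_param _ _ _) _; rewrite pE.
- move=> I k PI; have [y Qy] := reduction_complete (eq_leq (esym (pE k))) PI.
  have [t _ R] := Bq I k y (eq_leq (size_tuple y)).
  by exists y, t, (reduction (I, (k, tval y))).1, (reduction (I, (k, tval y))).2.
- move=> I k nP y t I' k' /Bdet[-> ->]; apply: contra_not nP; exact: reduction_sound.
Qed.
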